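(* The following problem is NP-hard: given a partially defined $3$-person game form $g$ (given by its table over $X_1\times X_2\times X_3$, with the set of outcomes $A$ part of the input and each profile either undefined or carrying an outcome), decide whether $g$ is assignable.
   Context: Let $X_1,X_2,X_3$ and $A$ be finite nonempty sets. A partially defined $3$-person game form is a map $g: D\to A$ with $D\subseteq X_1\times X_2\times X_3$. It is assignable if there exist functions $g_i: X_i\to A$, $i=1,2,3$, such that for every $x\in D$ there is $i$ with $g(x)=g_i(x_i)$. *)

(* Defs.v *)
From mathcomp Require Import all_boot.
Set Implicit Arguments. Unset Strict Implicit. Unset Printing Implicit Defensive.

(* A partially defined 3-person game form g : D -> A with
   D \subseteq X1 * X2 * X3, represented by its table:
   g x1 x2 x3 = None  iff (x1,x2,x3) \notin D. *)
Definition pgame_form (X1 X2 X3 A : Type) := X1 -> X2 -> X3 -> option A.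

Definition assignable (X1 X2 X3 A : Type) (g : pgame_form X1 X2 X3 A) : Prop :=
  exists (g1 : X1 -> A) (g2 : X2 -> A) (g3 : X3 -> A),
    forall x1 x2 x3 a, g x1 x2 x3 = Some a ->
      g1 x1 = a \/ g2 x2 = a \/ g3 x3 = a.

(* little-endian binary digits of n (fuel n suffices) *)
Fixpoint bits_aux (fuel n : nat) : seq bool :=
  match fuel with
  | 0 => [::]
  | f.+1 => if n is 0 then [::] else odd n :: bits_aux f n./2
  end.

(* self-delimiting binary encoding: every bit doubled, terminator 01 *)
Definition enc_nat (n : nat) : seq bool :=
  flatten [seq [:: b; b] | b <- bits_aux n n] ++ [:: false; true].

Definition enc_pair (w u : seq bool) : seq bool :=
  flatten [seq [:: b; b] | b <- w] ++ [:: false; true] ++ u.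

Definition enc_entry (m : nat) (e : option 'I_m) : seq bool :=
  if e is Some a then enc_nat (nat_of_ord a).+1 else enc_nat 0.

Definition enc_game (n1 n2 n3 m : nat) (g : pgame_form 'I_n1 'I_n2 'I_n3 'I_m)
  : seq bool :=
  enc_nat n1 ++ enc_nat n2 ++ enc_nat n3 ++ enc_nat m ++
  flatten (flatten (flatten
    [seq [seq [seq enc_entry (g x1 x2 x3) | x3 <- enum 'I_n3]
             | x2 <- enum 'I_n2]
         | x1 <- enum 'I_n1])).

Definition ASSIGNABILITY (w : seq bool) : Prop :=
  exists (n1 n2 n3 m : nat) (g : pgame_form 'I_n1 'I_n2 'I_n3 'I_m),
    [/\ 0 < n1, 0 < n2, 0 < n3 & 0 < m] /\
    w = enc_game g /\ assignable g.

Inductive move := MoveL | MoveR | Stay.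

(* tape symbols: Some b = bit b, None = blank *)
Record TM := {
  tm_state : finType;
  tm_start : tm_state;
  tm_halt : tm_state -> bool;
  tm_accept : tm_state -> bool;
  tm_delta : tm_state -> option bool -> tm_state * option bool * move
}.

Record config (M : TM) := Config {
  cf_state : tm_state M;
  cf_left : seq (option bool);   (* cells left of the head, nearest first *)
  cf_cur : option bool;
  cf_right : seq (option bool)   (* cells right of the head, nearest first *)
}.

Definition do_move (M : TM) (q : tm_state M) (l : seq (option bool))
    (s : option bool) (r : seq (option bool)) (mv : move) : config M :=
  match mv with
  | Stay => Config q l s r
  | MoveL => match l with
             | [::] => Config q [::] None (s :: r)
             | x :: l' => Config q l' x (s :: r)
             end
  | MoveR => match r with
             | [::] => Config q (s :: l) None [::]
             | x :: r' => Config q (s :: l) x r'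
             end
  end.

Definition tm_step (M : TM) (c : config M) : config M :=
  if tm_halt (cf_state c) then c else
  let: (q', s', mv) := tm_delta (cf_state c) (cf_cur c) in
  do_move q' (cf_left c) s' (cf_right c) mv.

Definition tm_run (M : TM) (t : nat) (c : config M) : config M :=
  iter t (@tm_step M) c.

Definition tm_init (M : TM) (w : seq bool) : config M :=
  match w with
  | [::] => Config (tm_start M) [::] None [::]
  | b :: w' => Config (tm_start M) [::] (Some b) [seq Some x | x <- w']
  end.

Definition halted (M : TM) (c : config M) : bool := tm_halt (cf_state c).

Fixpoint read_word (s : seq (option bool)) : seq bool :=
  match s with
  | Some b :: s' => b :: read_word s'
  | _ => [::]
  end.

Definition tm_output (M : TM) (c : config M) : seq bool :=
  read_word (cf_cur c :: cf_right c).

Definition poly_bound (c k n : nat) : nat := c * n.+1 ^ k.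

Definition poly_time_computable (f : seq bool -> seq bool) : Prop :=
  exists (M : TM) (c k : nat), forall w, exists t,
    t <= poly_bound c k (size w) /\
    halted (tm_run t (tm_init M w)) /\ tm_output (tm_run t (tm_init M w)) = f w.

Definition poly_time_decidable (L : seq bool -> Prop) : Prop :=
  exists (M : TM) (c k : nat), forall w, exists t,
    t <= poly_bound c k (size w) /\
    halted (tm_run t (tm_init M w)) /\
    (tm_accept (cf_state (tm_run t (tm_init M w))) <-> L w).

Definition in_NP (L : seq bool -> Prop) : Prop :=
  exists (V : seq bool -> Prop) (c k : nat),
    poly_time_decidable V /\
    forall w, L w <-> exists u, size u <= poly_bound c k (size w) /\ V (enc_pair w u).

Definition poly_reducible (L1 L2 : seq bool -> Prop) : Prop :=
  exists f, poly_time_computable f /\ forall w, L1 w <-> L2 (f w).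

Definition NP_hard (L : seq bool -> Prop) : Prop :=
  forall L', in_NP L' -> poly_reducible L' L.

(* Main.v *)
Require Import Defs.
From mathcomp Require Import all_boot zify.
From Stdlib Require Import FunctionalExtensionality.
Set Implicit Arguments. Unset Strict Implicit. Unset Printing Implicit Defensive.

(* An NP language is reduced to ASSIGNABILITY in one step, by a Turing machine
   that writes down a game describing the run of the verifier.

   The game.  Each player's positions are triples (t, j, a) with t, j < W and [a]
   an atom, such as "state q reading s", or "the j-th cell left (right) of the
   head contains s", at time t; indexing cells relatively to the head makes every
   transition local.  For players 1 and 2 the value 0 means "the fact is false",
   for player 3 the value 0 means "the fact is true"; so outcome 0 at (p1, p2, p3)
   is the Horn clause "p1 and p2 imply p3".  Outcome 1 links the copies of a fact
   from player 3 to players 1 and 2, and expresses binary choices, used to guess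
   the certificate.  A small block with six further outcomes forces auxiliary
   positions AS (true) and AF (false) to the value 2.  As all transition clauses
   are Horn, the facts of the actual run hold in every assignment, and no
   exclusivity constraints are needed.  W is a power of two larger than
   the running time, so that the information lost at the cells with j near W does
   not reach the head.

   The machine.  Turing machines are built from one-step machines by sequencing
   and looping.  Counters are stored in unary, as tracks of a tape made of blocks
   of bits ("columns"); the output grows to the left of the columns, hence is
   produced from its last bit to its first.  The table is emitted by loops over
   the coordinates of the three positions; whether a clause applies is a
   condition that has to hold in every column, so it is checked in one sweep. *)

(** * Structured Turing machine programs *)


(** Leaving the program with a result is itself a transition that writes and moves, so joining two
    programs costs no extra step. *)
Record prog (R : finType) := Prog {
  pst : finType;
  pstart : pst;
  pdelta : pst -> option bool -> (pst + R) * option bool * move }.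

Record tape := Tape {
  tleft : seq (option bool);
  tcur : option bool;
  tright : seq (option bool) }.

(* The head stands on the first cell of [s] (resp. [l]), or on a blank beyond it. *)
Definition mkr l s := Tape l (head None s) (behead s).
Definition mkl l r := Tape (behead l) (head None l) r.

Definition tmove (t : tape) (s : option bool) (mv : move) : tape :=
  match mv with
  | Stay => Tape (tleft t) s (tright t)
  | MoveL => mkl (tleft t) (s :: tright t)
  | MoveR => mkr (s :: tleft t) (tright t)
  end.

Inductive reach (R : finType) (P : prog R) : pst P -> tape -> nat -> R -> tape -> Prop :=
| ReachExit s t r b mv :
    pdelta s (tcur t) = (inr r, b, mv) -> reach s t 1 r (tmove t b mv)
| ReachStep s t s' b mv n r t' :
    pdelta s (tcur t) = (inl s', b, mv) ->
    reach s' (tmove t b mv) n r t' -> reach s t n.+1 r t'.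

(** [n] is only an upper bound on the number of steps, so costs may be rounded up wherever
    convenient. *)
Definition run (R : finType) (P : prog R) t n r t' :=
  exists2 n', n' <= n & reach (pstart P) t n' r t'.

Lemma run_le (R : finType) (P : prog R) t n n' r t' :
  run P t n r t' -> n <= n' -> run P t n' r t'.
Proof. by case=> k kn H nn'; exists k => //; apply: leq_trans nn'. Qed.

Definition act (R : finType) (f : option bool -> R * option bool * move) : prog R :=
  @Prog R unit tt (fun _ x => let: (r, b, mv) := f x in (inr r, b, mv)).

Lemma run_act (R : finType) (f : option bool -> R * option bool * move) t :
  run (act f) t 1 (f (tcur t)).1.1 (tmove t (f (tcur t)).1.2 (f (tcur t)).2).
Proof.
exists 1 => //; apply: ReachExit => /=; by case: (f _) => [[r b] mv].
Qed.

(** The second summand is a dependent pair because the state set of the continuation depends on the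
    result [r]; finite information read from the tape is thus kept in the control. *)
Definition bind_delta (R R' : finType) (P : prog R) (Q : R -> prog R')
  (s : pst P + {r : R & pst (Q r)}) (x : option bool) :
  (pst P + {r : R & pst (Q r)} + R') * option bool * move :=
  match s with
  | inl s => match pdelta s x with
             | (inl s', b, mv) => (inl (inl s'), b, mv)
             | (inr r, b, mv) => (inl (inr (existT _ r (pstart (Q r)))), b, mv)
             end
  | inr (existT r s) => match pdelta s x with
             | (inl s', b, mv) => (inl (inr (existT _ r s')), b, mv)
             | (inr r', b, mv) => (inr r', b, mv)
             end
  end.

Definition bind (R R' : finType) (P : prog R) (Q : R -> prog R') : prog R' :=
  @Prog R' (pst P + {r : R & pst (Q r)})%type (inl (pstart P)) (@bind_delta R R' P Q).

Lemma run_bind (R R' : finType) (P : prog R) (Q : R -> prog R') t n r t' n' r' t'' :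
  run P t n r t' -> run (Q r) t' n' r' t'' -> run (bind P Q) t (n + n') r' t''.
Proof.
case=> k kn HP [k' kn' HQ]; exists (k + k'); first exact: leq_add.
suff: forall s, @reach _ P s t k r t' -> @reach _ (bind P Q) (inl s) t (k + k') r' t''.
  by apply.
move=> s {}HP.
(* The run of the continuation is lifted into the composed machine first; it is then attached at the
   exit of [P], by induction on the run of [P]. *)
have HQ' : forall s0 t0, @reach _ (Q r) s0 t0 k' r' t'' ->
    @reach _ (bind P Q) (inr (existT _ r s0)) t0 k' r' t''.
  move=> s0 t0; elim=> {}s0 {}t0.
    by move=> r0 b mv E; apply: ReachExit; rewrite /= E.
  by move=> s1 b mv n0 r0 t1 E _ IH; apply: ReachStep IH; rewrite /= E.
elim: HP HQ' HQ => {kn s t k r t'} [s t r b mv E HQ' HQ|s t s1 b mv n0 r t' E _ IH HQ' HQ].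
  apply: ReachStep; first by rewrite /= E.
  exact: HQ'.
rewrite addSn; apply: ReachStep; first by rewrite /= E.
exact: IH.
Qed.

Definition loop (R : finType) (P : prog (option R)) : prog R :=
  @Prog R (pst P) (pstart P) (fun s x =>
    match pdelta s x with
    | (inl s', b, mv) => (inl s', b, mv)
    | (inr None, b, mv) => (inl (pstart P), b, mv)
    | (inr (Some r), b, mv) => (inr r, b, mv)
    end).

Lemma run_loop_exit (R : finType) (P : prog (option R)) t n r t' :
  run P t n (Some r) t' -> run (loop P) t n r t'.
Proof.
case=> k kn H; exists k => //=; move: H.
move: (pstart P) => s; move E: (Some r) => o H.
elim: H E => {}s {}t => [r0 b mv E Er|s' b mv n0 r0 t0 E _ IH Er].
  by apply: ReachExit; rewrite /= E -Er.
apply: ReachStep; last exact: IH Er.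
by rewrite /= E.
Qed.

Lemma run_loop_step (R : finType) (P : prog (option R)) t n t' n' r t'' :
  run P t n None t' -> run (loop P) t' n' r t'' -> run (loop P) t (n + n') r t''.
Proof.
case=> k kn H [k' kn' H']; exists (k + k'); first exact: leq_add.
move: H H' => /=.
have: forall s, @reach _ P s t k None t' -> @reach _ (loop P) (pstart P) t' k' r t'' ->
   @reach _ (loop P) s t (k + k') r t''; last by apply.
move=> s; move E: (None) => o H.
elim: H E => {kn k t'} {}s {}t => [r0 b mv E Er|s' b mv n0 r0 t0 E _ IH Er] H'.
  by apply: ReachStep H'; rewrite /= E -Er.
rewrite addSn; apply: ReachStep; last exact: IH Er H'.
by rewrite /= E.
Qed.

Definition rmap (R R' : finType) (f : R -> R') (P : prog R) : prog R' :=
  @Prog R' (pst P) (pstart P) (fun s x =>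
    match pdelta s x with
    | (inl s', b, mv) => (inl s', b, mv)
    | (inr r, b, mv) => (inr (f r), b, mv)
    end).

Lemma run_rmap (R R' : finType) (f : R -> R') (P : prog R) t n r t' :
  run P t n r t' -> run (rmap f P) t n (f r) t'.
Proof.
case=> k kn H; exists k => //=; move: H.
move: (pstart P) => s; elim=> {}s {}t.
  by move=> r0 b mv E; apply: ReachExit; rewrite /= E.
by move=> s1 b mv n0 r0 t1 E _ IH; apply: ReachStep IH; rewrite /= E.
Qed.

(** The added state is the only halting one. Nothing is accepted, since a transducer is judged by
    its output. *)
Definition tm_of (P : prog unit) : TM :=
  @Build_TM (pst P + unit)%type (inl (pstart P))
    (fun s => if s is inr _ then true else false) xpred0
    (fun s x => match s with
                | inl s => pdelta s x
                | inr r => (inr r, x, Stay)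
                end).

Lemma tm_of_run (P : prog unit) t n t' :
  run P t n tt t' ->
  exists2 n', n' <= n &
    tm_run n' (@Config (tm_of P) (inl (pstart P)) (tleft t) (tcur t) (tright t)) =
    @Config (tm_of P) (inr tt) (tleft t') (tcur t') (tright t').
Proof.
case=> k kn H; exists k => //; move: (pstart P) H => s H.
move E: tt H => r H.
have mvE (q : tm_state (tm_of P)) t0 b mv :
   @do_move (tm_of P) q (tleft t0) b (tright t0) mv =
   @Config (tm_of P) q (tleft (tmove t0 b mv)) (tcur (tmove t0 b mv)) (tright (tmove t0 b mv)).
  case: mv => //=; first by case: (tleft t0).
  by case: (tright t0).
elim: H E => {kn k n}  {}s {}t.
  by move=> r0 b mv E Er; rewrite /tm_run /= /tm_step /= E /= mvE; case: r0 E Er.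
move=> s1 b mv n0 r0 t1 E _ IH Er.
rewrite /tm_run iterSr.
by have -> : tm_step (@Config (tm_of P) (inl s) (tleft t) (tcur t) (tright t)) =
  @Config (tm_of P) (inl s1) (tleft (tmove t b mv)) (tcur (tmove t b mv)) (tright (tmove t b mv));
  [rewrite /tm_step /= E mvE | exact: IH].
Qed.

Definition skip : prog unit := act (fun x => (tt, x, Stay)).
Definition seqp (R R' : finType) (P : prog R) (Q : prog R') := bind P (fun _ => Q).
Notation "P ;; Q" := (seqp P Q) (at level 61, right associativity).

Lemma run_seqp (R R' : finType) (P : prog R) (Q : prog R') t n r t' n' r' t'' :
  run P t n r t' -> run Q t' n' r' t'' -> run (P ;; Q) t (n + n') r' t''.
Proof. exact: run_bind. Qed.

Lemma mklE x l r : mkl (x :: l) r = mkr l (x :: r).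
Proof. by []. Qed.

Lemma run_skip t : run skip t 1 tt t.
Proof. by have := run_act (fun x => (tt, x, Stay)) t; case: t. Qed.

Definition stepR : prog unit := act (fun x => (tt, x, MoveR)).
Definition stepL : prog unit := act (fun x => (tt, x, MoveL)).

Lemma run_stepR l s : run stepR (mkr l s) 1 tt (mkr (head None s :: l) (behead s)).
Proof. exact: (run_act (fun x => (tt, x, MoveR)) (mkr l s)). Qed.

Lemma run_stepL l s : run stepL (mkr l s) 1 tt (mkl l (head None s :: behead s)).
Proof. exact: (run_act (fun x => (tt, x, MoveL)) (mkr l s)). Qed.

Definition goL : prog unit :=
  loop (act (fun x => if x is Some _ then (None, x, MoveL) else (Some tt, x, Stay))).
Definition goR : prog unit :=
  loop (act (fun x => if x is Some _ then (None, x, MoveR) else (Some tt, x, Stay))).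

(** The condition [head None l = None] covers both a written blank and the end of the list; [catrev]
    appears because the cells passed over pile up in reverse order on the other side. *)
Lemma run_goL (cs : seq bool) l r : head None l = None ->
  run goL (mkl (map Some cs ++ l) r) (size cs).+1 tt
          (Tape (behead l) None (catrev (map Some cs) r)).
Proof.
move=> hl; elim: cs r => [|b cs IH] r.
  apply: run_loop_exit.
  have := run_act (fun x : option bool => if x is Some _ then (None, x, MoveL) else (Some tt, x, Stay)) (mkl l r).
  by rewrite /= hl.
apply: (@run_loop_step _ _ _ 1); last exact: IH.
exact: (run_act (fun x : option bool => if x is Some _ then (None, x, MoveL) else (Some tt, x, Stay))
          (mkl (Some b :: map Some cs ++ l) r)).
Qed.

Lemma run_goR (cs : seq bool) l s : head None s = None ->
  run goR (mkr l (map Some cs ++ s)) (size cs).+1 tt (mkr (catrev (map Some cs) l) s).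
Proof.
move=> hs; elim: cs l => [|b cs IH] l.
  apply: run_loop_exit.
  have := run_act (fun x : option bool => if x is Some _ then (None, x, MoveR) else (Some tt, x, Stay)) (mkr l s).
  by rewrite /= hs -{2}hs.
apply: (@run_loop_step _ _ _ 1); last exact: IH.
exact: (run_act (fun x : option bool => if x is Some _ then (None, x, MoveR) else (Some tt, x, Stay))
          (mkr l (Some b :: map Some cs ++ s))).
Qed.

Fixpoint readn (n : nat) : prog (n.-tuple bool) :=
  match n return prog (n.-tuple bool) with
  | 0 => rmap (fun _ => [tuple]) skip
  | n'.+1 => bind (act (fun x => (odflt false x, x, MoveR)))
                  (fun b => rmap (fun t => cons_tuple b t) (readn n'))
  end.

Lemma run_readn n (c : n.-tuple bool) l s :
  run (readn n) (mkr l (map Some c ++ s)) n.+1 c (mkr (catrev (map Some c) l) s).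
Proof.
elim: n c l => [|n IH] c l /=.
  rewrite (tuple0 c) /=; exact: (run_rmap (fun _ => [tuple]) (run_skip (mkr l s))).
case/tupleP: c => b c.
apply: (@run_bind _ _ _ _ _ 1 b); last exact: run_rmap (IH c _).
exact: (run_act (fun x => (odflt false x, x, MoveR)) (mkr l (Some b :: map Some c ++ s))).
Qed.

Fixpoint wr (c : seq bool) : prog unit :=
  if c is b :: c' then act (fun _ => (tt, Some b, MoveR)) ;; wr c' else skip.

Lemma run_wr c l s :
  run (wr c) (mkr l s) (size c).+1 tt (mkr (catrev (map Some c) l) (drop (size c) s)).
Proof.
elim: c l s => [|b c IH] l s /=; first by rewrite drop0; exact: run_skip.
apply: (@run_seqp _ _ _ _ _ 1 tt).
  exact: (run_act (fun _ => (tt, Some b, MoveR)) (mkr l s)).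
rewrite -/(mkr _ (behead s)).
by have := IH (Some b :: l) (behead s); case: s => //.
Qed.

Fixpoint backn (n : nat) : prog unit := if n is n'.+1 then stepL ;; backn n' else skip.

Lemma run_backn n (c : seq bool) l x s : size c = n ->
  run (backn n) (mkr (catrev (map Some c) l) (x :: s)) n.+1 tt
                (mkr l (map Some c ++ x :: s)).
Proof.
move=> <- {n}; elim/last_ind: c x s => [|c b IH] x s; first exact: run_skip.
rewrite size_rcons /= map_rcons -cats1 catrev_catl /=.
apply: (@run_seqp _ _ _ _ _ 1 tt); first exact: run_stepL.
by rewrite mklE /= -catA; exact: IH.
Qed.

(** * Columns of bits on the tape *)


Definition ret (R : finType) (r : R) : prog R := rmap (fun _ => r) skip.

Lemma run_ret (R : finType) (r : R) t : run (ret r) t 1 r t.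
Proof. exact: (run_rmap (fun _ => r) (run_skip t)). Qed.

Section Columns.

Variable K : nat.
Notation B := K.+2.
Notation column := (B.-tuple bool).

Definition bit (c : column) (i : nat) : bool := nth false c i.
Definition mkcol (F : nat -> bool) : column := [tuple F (nat_of_ord i) | i < B].
Definition setbit (c : column) (i : nat) (b : bool) : column :=
  mkcol (fun j => if j == i then b else bit c j).
Definition col0 : column := mkcol (fun _ => false).

Lemma bit_mkcol F i : i < B -> bit (mkcol F) i = F i.
Proof. by move=> iB; rewrite /bit (nth_mktuple _ _ (Ordinal iB)). Qed.

Lemma columnP (c c' : column) : (forall i, i < B -> bit c i = bit c' i) -> c = c'.
Proof. by move=> H; apply: eq_from_tnth => i; rewrite !(tnth_nth false); apply: H. Qed.

Definition cells (cs : seq column) : seq bool := flatten [seq tval c | c <- cs].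
Definition fl (cs : seq column) : seq (option bool) := map Some (cells cs).

Lemma fl_cat cs cs' : fl (cs ++ cs') = fl cs ++ fl cs'.
Proof. by rewrite /fl /cells map_cat flatten_cat map_cat. Qed.

Lemma fl_cons c cs : fl (c :: cs) = map Some c ++ fl cs.
Proof. by rewrite -cat1s fl_cat /fl /cells /= cats0. Qed.

Lemma fl_rcons cs c : fl (rcons cs c) = fl cs ++ map Some c.
Proof. by rewrite -cats1 fl_cat /fl /cells /= cats0. Qed.

Lemma size_cells cs : size (cells cs) = size cs * B.
Proof.
by elim: cs => //= c cs IH; rewrite /cells /= size_cat -/(cells cs) IH size_tuple; lia.
Qed.

(* The head stands on the boundary between the columns [pre] and [post]; the
   blank cell left of the columns separates them from the output. *)
Definition zipper (L : seq (option bool)) (pre post : seq column) (b : nat) : tape :=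
  mkr (catrev (fl pre) (None :: L)) (fl post ++ nseq b.+1 None).

(** One cell tells a further column from the end of the columns, because cells of columns are never
    blank. *)
Definition fwd : prog (option column) :=
  bind (act (fun x => (isSome x, x, Stay)))
       (fun v => if v then rmap Some (readn B) else ret None).

Lemma run_peek l s :
  run (act (fun x => (isSome x, x, Stay))) (mkr l s) 1 (isSome (head None s)) (mkr l s).
Proof. exact: (run_act (fun x => (isSome x, x, Stay)) (mkr l s)). Qed.

Lemma run_fwd_cons L pre c post b :
  run fwd (zipper L pre (c :: post) b) (1 + B.+1) (Some c) (zipper L (rcons pre c) post b).
Proof.
apply: (@run_bind _ _ _ _ _ 1 true (zipper L pre (c :: post) b)).
  have := run_peek (catrev (fl pre) (None :: L)) (fl (c :: post) ++ nseq b.+1 None).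
  by rewrite /zipper fl_cons; case/tupleP: c => x c'; exact.
rewrite /zipper fl_cons -catA fl_rcons catrev_catl.
apply: run_rmap; exact: run_readn.
Qed.

Lemma run_fwd_nil L pre b :
  run fwd (zipper L pre [::] b) (1 + B.+1) None (zipper L pre [::] b).
Proof.
apply: (@run_bind _ _ _ _ _ 1 false); first exact: run_peek.
exact: run_le (run_ret _ _) _.
Qed.

Lemma run_back L pre c post b :
  run (backn B) (zipper L (rcons pre c) post b) B.+1 tt (zipper L pre (c :: post) b).
Proof.
rewrite /zipper fl_rcons fl_cons catrev_catl -catA.
case: (fl post) => [|x s] /=.
  by apply: run_backn; rewrite size_tuple.
by apply: run_backn; rewrite size_tuple.
Qed.

Lemma run_wr_cons L pre (c c' : column) post b :
  run (wr c') (zipper L pre (c :: post) b) B.+1 tt (zipper L (rcons pre c') post b).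
Proof.
rewrite /zipper fl_rcons fl_cons catrev_catl -catA.
have := run_wr c' (catrev (fl pre) (None :: L)) (map Some c ++ (fl post ++ nseq b.+1 None)).
rewrite size_tuple drop_cat size_map size_tuple ltnn subnn drop0; exact.
Qed.

Lemma run_wr_nil L pre (c' : column) b :
  exists b', run (wr c') (zipper L pre [::] b) B.+1 tt (zipper L (rcons pre c') [::] b').
Proof.
exists (b - B).
rewrite /zipper fl_rcons catrev_catl.
have := run_wr c' (catrev (fl pre) (None :: L)) (nseq b.+1 None).
rewrite size_tuple drop_nseq /= subSS.
(* The list may record fewer blanks than a column overwrites; [mkr] then identifies the empty list
   with a single blank. *)
have [bB|bB] := leqP b K.+1; last by rewrite -(subnSK bB).
have -> : b - K.+1 = 0 by lia.
have -> : b - B = 0 by lia.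
exact.
Qed.

(** The first step to the left is needed since the head may already stand on a blank, behind the
    last column; [goL] then stops at the separator. *)
Definition home : prog unit := stepL ;; goL ;; stepR.

Lemma run_home L pre post b :
  run home (zipper L pre post b) (1 + ((size pre * B).+1 + 1)) tt (zipper L [::] (pre ++ post) b).
Proof.
apply: run_seqp; first exact: run_stepL.
set s := head _ _ :: _.
have -> : catrev (fl pre) (None :: L) = map Some (rev (cells pre)) ++ None :: L.
  by rewrite catrevE /fl map_rev.
apply: run_seqp.
  have := @run_goL (rev (cells pre)) (None :: L) s erefl.
  rewrite size_rev size_cells; exact.
have := run_stepR L (None :: catrev (map Some (rev (cells pre))) s).
rewrite /zipper /= fl_cat catrevE map_rev revK -catA /fl.
have -> : s = map Some (cells post) ++ nseq b.+1 None.
  by rewrite /s /fl; case: (cells post).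
exact.
Qed.

(** A column can only be tested after it has been read, so a violating one has to be stepped back
    over before it is returned. *)
Definition skipw (p : pred column) : prog (option column) :=
  loop (bind fwd (fun o =>
    if o is Some c then
      if p c then ret None else rmap (fun _ => Some (Some c)) (backn B)
    else ret (Some None))).

Lemma run_skipw p L pre cs post b : all p cs -> (forall c, ohead post = Some c -> ~~ p c) ->
  run (skipw p) (zipper L pre (cs ++ post) b)
    (size cs * (B + 3) + (B.+2 + B.+1)) (ohead post) (zipper L (pre ++ cs) post b).
Proof.
move=> + hp; elim: cs pre => [|c cs IH] pre /=.
  move=> _; rewrite cats0 mul0n add0n; case: post hp => [|c post] hp.
    apply: run_loop_exit; apply: run_bind; first exact: run_fwd_nil.
    apply: run_le; first exact: run_ret.
    by [].
  apply: run_loop_exit; apply: run_bind; first exact: run_fwd_cons.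
  lazy beta iota; rewrite (negbTE (hp c erefl)).
  apply: (run_rmap (fun _ => Some (Some c))); exact: run_back.
case/andP=> pc pcs.
have := IH (rcons pre c) pcs; rewrite cat_rcons => IH'.
apply: run_le (_ : ((1 + B.+1 + 1) + (size cs * (B + 3) + (B.+2 + B.+1))) <= _).
  apply: run_loop_step IH'.
  apply: run_bind; first exact: run_fwd_cons.
  lazy beta iota; rewrite pc; exact: run_ret.
by rewrite mulSn; lia.
Qed.

Definition allc (p : pred column) : prog bool :=
  bind (skipw p) (fun o => rmap (fun _ => o == None) home).

Lemma split_all (T : Type) (p : pred T) (s : seq T) :
  exists s1 s2, [/\ s = s1 ++ s2, all p s1, (forall c, ohead s2 = Some c -> ~~ p c)
    & (ohead s2 = None) <-> all p s].
Proof.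
elim: s => [|x s [s1 [s2 [-> a1 h2 e]]]]; first by exists [::], [::].
have [px|px] := boolP (p x).
  exists (x :: s1), s2; split=> //=; first by rewrite px.
  by rewrite px.
exists [::], (x :: s1 ++ s2); split=> //= [c [<-]//|]; by rewrite (negbTE px).
Qed.

Lemma run_allc p L cs b :
  run (allc p) (zipper L [::] cs b) ((size cs).+1 * (3 * B + 10)) (all p cs) (zipper L [::] cs b).
Proof.
have [s1 [s2 [E a1 h2 e]]] := split_all p cs.
apply: run_le.
  apply: run_bind.
    by rewrite {1}E; apply: run_skipw a1 h2.
  have -> : all p cs = (ohead s2 == None).
    by apply/idP/eqP => H; apply/e.
  apply: (run_rmap (fun _ => ohead s2 == None)).
  rewrite [X in zipper L [::] X b]E; exact: run_home.
have: size s1 <= size cs; [by rewrite E size_cat; lia | rewrite /= => H; have := leq_mul H (leqnn (3 * B + 10)); lia].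
Qed.

Definition mapc (f : column -> column) : prog unit :=
  loop (bind fwd (fun o =>
    if o is Some c then backn B ;; wr (f c) ;; ret None else ret (Some tt))) ;; home.

Lemma run_mapc f L cs b :
  run (mapc f) (zipper L [::] cs b) ((size cs).+1 * (4 * B + 20)) tt (zipper L [::] (map f cs) b).
Proof.
apply: run_le.
  apply: run_seqp; last by rewrite -[map f cs]cats0; apply: run_home.
  have: forall cs pre, run (loop (bind fwd (fun o =>
    if o is Some c then backn B ;; wr (f c) ;; ret None else ret (Some tt))))
    (zipper L pre cs b) (size cs * (3 * B + 7) + (B + 3)) tt (zipper L (pre ++ map f cs) [::] b).
    elim=> [|c s IH] pre /=.
      rewrite cats0; apply: run_loop_exit; apply: run_le.
        by apply: run_bind; [exact: run_fwd_nil | exact: run_ret].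
      by lia.
    apply: run_le.
      apply: run_loop_step; last by have := IH (rcons pre (f c)); rewrite cat_rcons; exact.
      apply: run_bind; first exact: run_fwd_cons.
      apply: run_seqp; first exact: run_back.
      apply: run_seqp; first exact: run_wr_cons.
      exact: run_ret.
    by rewrite ?mulSn; lia.
  by move/(_ cs [::]); exact.
by rewrite size_map; nia.
Qed.

(** In unary, adding one sets bit [i] in the first column lacking it; if there is none, a fresh
    column built from [col0] is appended. *)
Definition incp (i : nat) : prog unit :=
  bind (skipw (bit^~ i)) (fun o => wr (setbit (odflt col0 o) i true)) ;; home.

Lemma run_incp_cons i L cs c post b : all (bit^~ i) cs -> ~~ bit c i ->
  run (incp i) (zipper L [::] (cs ++ c :: post) b) ((size cs).+1 * (4 * B + 20)) tt
      (zipper L [::] (cs ++ setbit c i true :: post) b).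
Proof.
move=> a1 h; apply: run_le.
  apply: run_seqp; last by rewrite -cat_rcons; apply: run_home.
  have h' : forall c0, ohead (c :: post) = Some c0 -> ~~ bit c0 i by move=> _ [<-].
  apply: run_bind; first exact (run_skipw L [::] b a1 h').
  exact: run_wr_cons.
by rewrite size_rcons; nia.
Qed.

Lemma run_incp_nil i L cs b : all (bit^~ i) cs -> exists b',
  run (incp i) (zipper L [::] cs b) ((size cs).+1 * (4 * B + 20)) tt
      (zipper L [::] (rcons cs (setbit col0 i true)) b').
Proof.
move=> a1.
have [b' H] := run_wr_nil L cs (setbit col0 i true) b; exists b'; apply: run_le.
  apply: run_seqp; last by rewrite -[rcons _ _]cats0; apply: run_home.
  apply: run_bind.
    rewrite -[X in zipper L _ X _]cats0.
    have h' : forall c0, ohead (Nil column) = Some c0 -> ~~ bit c0 i by [].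
    exact (run_skipw L [::] b a1 h').
  exact: H.
by rewrite size_rcons; nia.
Qed.

(** The column to change lies just before the first one without bit [i]; it is read again so that
    its other bits survive the rewriting. *)
Definition decp (i : nat) : prog unit :=
  skipw (bit^~ i) ;; backn B ;;
  bind fwd (fun o => backn B ;; wr (setbit (odflt col0 o) i false)) ;; home.

Lemma run_decp i L cs c post b : all (bit^~ i) (rcons cs c) ->
  (forall c, ohead post = Some c -> ~~ bit c i) ->
  run (decp i) (zipper L [::] (cs ++ c :: post) b) ((size cs).+1 * (9 * B + 30)) tt
      (zipper L [::] (cs ++ setbit c i false :: post) b).
Proof.
move=> a1 h; apply: run_le.
  apply: run_seqp; first by rewrite -cat_rcons; exact (run_skipw L [::] b a1 h).
  apply: run_seqp; first exact: run_back.
  apply: run_seqp; last by rewrite -cat_rcons; apply: run_home.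
  apply: run_bind; first exact: run_fwd_cons.
  apply: run_seqp; first exact: run_back.
  exact: run_wr_cons.
by rewrite !size_rcons; nia.
Qed.

(** Two steps to the left cross the separator; the letter goes to the first blank beyond the output,
    so that letters are prepended. *)
Definition emitp (b : bool) : prog unit :=
  stepL ;; stepL ;; goL ;; act (fun _ => (tt, Some b, MoveR)) ;; goR ;; stepR.

(** The left part of a tape is listed nearest cell first, hence [rev]; the [a] blanks are cells
    beyond the output that the list happens to contain. *)
Definition outl (o : seq bool) (a : nat) : seq (option bool) :=
  map Some (rev o) ++ nseq a None.

Lemma run_emitp x o a cs b :
  run (emitp x) (zipper (outl o a) [::] cs b) ((size o).+1 * 10) tt
      (zipper (outl (x :: o) a.-1) [::] cs b).
Proof.
rewrite /zipper /=; set s := _ ++ _.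
have Es : head None s :: behead s = s by rewrite /s; case: (fl cs).
apply: run_le.
  apply: run_seqp; first exact: run_stepL.
  rewrite Es mklE.
  apply: run_seqp; first exact: run_stepL.
  apply: run_seqp.
    by apply: run_goL; case: (a).
  apply: (@run_seqp _ _ _ _ _ 1 tt).
    exact: run_act (fun _ => (tt, Some x, MoveR)) _.
  rewrite /= catrevE -map_rev revK.
  apply: run_seqp.
    by apply: run_goR.
  have := run_stepR (catrev (map Some o) (Some x :: behead (nseq a None))) (None :: s).
  have -> : catrev (map Some o) (Some x :: behead (nseq a None)) = outl (x :: o) a.-1.
    by rewrite catrevE /outl rev_cons map_rcons cat_rcons map_rev; case: (a).
  exact.
by rewrite size_rev; lia.
Qed.

End Columns.

(** * Programs over unary counters *)


Record store := Store { cnt : nat -> nat; out : seq bool }.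

Definition updf (f : nat -> nat) i v j : nat := if j == i then v else f j.
Definition upd σ i v := Store (updf (cnt σ) i v) (out σ).
Definition push str σ := Store (cnt σ) (str ++ out σ).

Lemma store_ext σ σ' : (forall i, cnt σ i = cnt σ' i) -> out σ = out σ' -> σ = σ'.
Proof.
case: σ σ' => [f o] [f' o'] /= e ->; congr Store; exact: functional_extensionality.
Qed.

Lemma updfE f i v : updf f i v i = v.
Proof. by rewrite /updf eqxx. Qed.

Lemma updf_id f i v : f i = v -> updf f i v = f.
Proof. by move=> <-; apply: functional_extensionality => j; rewrite /updf; case: eqP => // ->. Qed.

Lemma updf_updf f i v v' : updf (updf f i v) i v' = updf f i v'.
Proof. by apply: functional_extensionality => j; rewrite /updf; case: eqP. Qed.

Lemma upd_id σ i v : cnt σ i = v -> upd σ i v = σ.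
Proof. by case: σ => f o /= e; rewrite /upd /= updf_id. Qed.

Lemma upd_upd σ i v v' : upd (upd σ i v) i v' = upd σ i v'.
Proof. by rewrite /upd /= updf_updf. Qed.

Lemma updfC f i j v w : i != j -> updf (updf f i v) j w = updf (updf f j w) i v.
Proof.
move=> /eqP ij; apply: functional_extensionality => k; rewrite /updf.
by case: (k =P j) => // ->; case: eqP => // ji; case: ij.
Qed.

Lemma push_cat s1 s2 σ : push s1 (push s2 σ) = push (s1 ++ s2) σ.
Proof. by rewrite /push /= catA. Qed.

Section Programs.

Variables (K : nat) (z : seq bool).
Notation B := K.+2.
Notation column := (B.-tuple bool).

(* Column [x] holds, for every counter [i], whether [x] is below its value, and
   in its last two bits whether [z] has a letter at position [x], and which. *)
Definition colf σ x : column :=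
  mkcol K (fun i => if i < K then x < cnt σ i else
                    if i == K then x < size z else nth false z x).

Definition wf m σ := size z <= m /\ forall i, i < K -> cnt σ i <= m.

Definition Rep σ m t :=
  wf m σ /\ exists a b, t = zipper (outl (out σ) a) [::] (mkseq (colf σ) m) b.

Definition opcost := 9 * B + 40.

(** The cost [n] plays two roles: it counts elementary operations, and it bounds the growth of
    columns plus output. A constant times [m + size (out σ) + n] then bounds each operation. The
    numbers of columns and of surrounding blanks stay hidden. *)
Definition spec (R : finType) (P : prog R) σ n r σ' := forall m t, Rep σ m t ->
  exists m' t', [/\ Rep σ' m' t', m' + size (out σ') <= m + size (out σ) + n &
    run P t (n * (opcost * (m + size (out σ) + n).+1)) r t'].

Lemma spec_le (R : finType) (P : prog R) σ n n' r σ' :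
  n <= n' -> spec P σ n r σ' -> spec P σ n' r σ'.
Proof.
move=> nn' H m t /H [m' [t' [H1 H2 H3]]]; exists m', t'; split=> //.
  by apply: leq_trans H2 _; rewrite leq_add2l.
apply: run_le H3 _; apply: leq_mul => //; rewrite leq_mul2l ltnS leq_add2l nn'.
by rewrite orbT.
Qed.

(** The second program starts at size at most [s + n], so both summands are bounded using the common
    size [s + (n + n')]. *)
Lemma cost_add s n s' n' C : s' <= s + n ->
  n * (C * (s + n).+1) + n' * (C * (s' + n').+1) <= (n + n') * (C * (s + (n + n')).+1).
Proof.
move=> H; rewrite mulnDl; apply: leq_add; rewrite !leq_mul2l; apply/orP; right;
  apply/orP; right; lia.
Qed.

Lemma spec_bind (R R' : finType) (P : prog R) (Q : R -> prog R') σ n r σ' n' r' σ'' :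
  spec P σ n r σ' -> spec (Q r) σ' n' r' σ'' -> spec (bind P Q) σ (n + n') r' σ''.
Proof.
move=> HP HQ m t /HP [m1 [t1 [/HQ [m2 [t2 [R2 s2 r2]]] s1 r1]]].
exists m2, t2; split=> //; first lia.
apply: run_le (run_bind r1 r2) _; exact: cost_add.
Qed.

Lemma spec_seqp (R R' : finType) (P : prog R) (Q : prog R') σ n r σ' n' r' σ'' :
  spec P σ n r σ' -> spec Q σ' n' r' σ'' -> spec (P ;; Q) σ (n + n') r' σ''.
Proof. exact: spec_bind. Qed.

Lemma spec_loop_exit (R : finType) (P : prog (option R)) σ n r σ' :
  spec P σ n (Some r) σ' -> spec (loop P) σ n r σ'.
Proof.
move=> HP m t /HP [m1 [t1 [H1 H2 H3]]]; exists m1, t1; split=> //.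
exact: run_loop_exit.
Qed.

Lemma spec_loop_step (R : finType) (P : prog (option R)) σ n σ' n' r σ'' :
  spec P σ n None σ' -> spec (loop P) σ' n' r σ'' -> spec (loop P) σ (n + n') r σ''.
Proof.
move=> HP HQ m t /HP [m1 [t1 [/HQ [m2 [t2 [R2 s2 r2]]] s1 r1]]].
exists m2, t2; split=> //; first lia.
apply: run_le (run_loop_step r1 r2) _; exact: cost_add.
Qed.

Lemma spec_intro (R : finType) (P : prog R) σ r σ' :
  (forall m a b, wf m σ -> exists m' a' b' k,
     [/\ wf m' σ', m' + size (out σ') <= (m + size (out σ)).+1,
         run P (zipper (outl (out σ) a) [::] (mkseq (colf σ) m) b) k r
               (zipper (outl (out σ') a') [::] (mkseq (colf σ') m') b') &
         k <= opcost * (m + size (out σ) + 1).+1]) ->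
  spec P σ 1 r σ'.
Proof.
move=> H m t [Hm [a [b ->]]]; have [m' [a' [b' [k [w1 s1 r1 c1]]]]] := H m a b Hm.
exists m', (zipper (outl (out σ') a') [::] (mkseq (colf σ') m') b'); split.
- by split=> //; exists a', b'.
- by rewrite addn1.
- by rewrite mul1n; apply: run_le r1 c1.
Qed.

Lemma spec_ret (R : finType) (r : R) σ : spec (ret r) σ 1 r σ.
Proof.
apply: spec_intro => m a b Hm; exists m, a, b, 1; split=> //; exact: run_ret.
Qed.

Lemma bit_colf σ x i : i < K -> bit (colf σ x) i = (x < cnt σ i).
Proof. by move=> iK; rewrite bit_mkcol ?iK //; lia. Qed.

Lemma spec_allc (p : pred column) v σ :
  (forall m, wf m σ -> all p (mkseq (colf σ) m) = v) -> spec (allc p) σ 1 v σ.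
Proof.
move=> H; apply: spec_intro => m a b Hm; rewrite -(H m Hm).
exists m, a, b, ((size (mkseq (colf σ) m)).+1 * (3 * B + 10)); split=> //.
  exact: run_allc.
by rewrite size_mkseq /opcost; nia.
Qed.

Definition set_counter i j : prog unit := mapc (fun c : column => setbit c i (bit c j)).
Definition clear i : prog unit := mapc (fun c : column => setbit c i false).

Lemma wf_upd m σ i v : wf m σ -> v <= m -> wf m (upd σ i v).
Proof.
by case=> sz H vm; split=> // j jK; rewrite /= /updf; case: eqP => // _; apply: H.
Qed.

Lemma colf_upd σ i v x : i < K -> colf (upd σ i v) x = setbit (colf σ x) i (x < v).
Proof.
move=> iK; apply: columnP => j jB; rewrite !bit_mkcol //= /updf.
by case: (j =P i) => [->|_]; rewrite ?iK.
Qed.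

(** The new value has to fit into the existing columns, because a sweep never appends one. *)
Lemma spec_mapc (f : column -> column) σ i v : i < K ->
  (forall m, wf m σ -> v <= m) ->
  (forall x, f (colf σ x) = setbit (colf σ x) i (x < v)) ->
  spec (mapc f) σ 1 tt (upd σ i v).
Proof.
move=> iK vle fE; apply: spec_intro => m a b Hm.
exists m, a, b, ((size (mkseq (colf σ) m)).+1 * (4 * B + 20)); split.
- by apply: wf_upd => //; apply: vle.
- by [].
- have -> : mkseq (colf (upd σ i v)) m = map f (mkseq (colf σ) m).
    by rewrite /mkseq -map_comp; apply: eq_map => x; rewrite /= fE colf_upd.
  exact: run_mapc.
- by rewrite size_mkseq /opcost; nia.
Qed.

Lemma spec_set_counter σ i j : i < K -> j < K ->
  spec (set_counter i j) σ 1 tt (upd σ i (cnt σ j)).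
Proof.
move=> iK jK; apply: spec_mapc => // [m [_]|x]; first exact.
by rewrite bit_colf.
Qed.

Lemma spec_clear σ i : i < K -> spec (clear i) σ 1 tt (upd σ i 0).
Proof. by move=> iK; apply: spec_mapc. Qed.

Lemma mkseq_split (T : Type) (f : nat -> T) v m : v < m ->
  mkseq f m = mkseq f v ++ f v :: map f (iota v.+1 (m - v.+1)).
Proof.
move=> vm; rewrite /mkseq -{1}(subnKC (ltnW vm)) iotaD map_cat; congr cat.
by rewrite add0n; have -> : m - v = (m - v.+1).+1 by lia.
Qed.

(** Only column [v] sees the change, which covers both an increment from [v] and a decrement to
    [v]. *)
Lemma mkseq_colf_upd σ i v v' m : i < K -> v < m ->
  (forall x, x < m -> x != v -> (x < v') = (x < cnt σ i)) ->
  mkseq (colf (upd σ i v')) m =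
  mkseq (colf σ) v ++ setbit (colf σ v) i (v < v') :: map (colf σ) (iota v.+1 (m - v.+1)).
Proof.
move=> iK vm H.
have same x : x < m -> x != v -> colf (upd σ i v') x = colf σ x.
  move=> xm xv; rewrite colf_upd // H //; apply: columnP => j jB.
  by rewrite bit_mkcol //; case: eqP => // ->; rewrite bit_colf.
rewrite (mkseq_split _ vm) colf_upd //; congr cat; last congr cons.
  by apply/eq_in_map => x; rewrite mem_iota add0n => /andP[_ xv]; apply: same; lia.
by apply/eq_in_map => x; rewrite mem_iota => /andP[vx xv]; apply: same; lia.
Qed.

Lemma spec_inc σ i : i < K -> spec (@incp K i) σ 1 tt (upd σ i (cnt σ i).+1).
Proof.
move=> iK; apply: spec_intro => m a b Hm.
have [sz Hc] := Hm; set v := cnt σ i.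
have allv : all (@bit K ^~ i) (mkseq (colf σ) v).
  by apply/allP => c /mapP[x]; rewrite mem_iota => /andP[_ xv] ->; rewrite bit_colf.
(* Either the counter fills all [m] columns and a new one is appended, or the column to change
   exists. *)
have := Hc _ iK; rewrite -/v leq_eqVlt => /orP[/eqP vm|vm].
  have [b' Hrun] := run_incp_nil (outl (out σ) a) b allv.
  exists m.+1, a, b', (v.+1 * (4 * B + 20)); split.
  - by split=> [|j jK /=]; [lia | rewrite /updf; case: eqP => _; [lia | have := Hc _ jK; lia]].
  - by rewrite /=; lia.
  - have := Hrun; rewrite size_mkseq vm.
    suff -> : mkseq (colf (upd σ i m.+1)) m.+1 =
        rcons (mkseq (colf σ) m) (setbit (col0 K) i true) by [].
    rewrite /mkseq -(addn1 m) iotaD map_cat cats1 /= add0n; congr rcons.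
      apply/eq_in_map => x; rewrite mem_iota add0n => /andP[_ xm].
      rewrite colf_upd //; apply: columnP => j jB; rewrite bit_mkcol //.
      by case: eqP => // ->; rewrite bit_colf //; lia.
    (* The new column has number [m], which is at least [size z] and at least every counter, so its
       other bits are false. *)
    rewrite colf_upd // addn1 ltnSn; apply: columnP => j jB; rewrite !bit_mkcol //.
    case: eqP => // _; case: ifP => [jK|_]; first by have := Hc _ jK; lia.
    by case: eqP => // _; [lia | rewrite nth_default].
  - by rewrite /opcost; nia.
exists m, a, b, (v.+1 * (4 * B + 20)); split.
- exact: wf_upd.
- by rewrite /=; lia.
- rewrite (mkseq_split _ vm) (@mkseq_colf_upd _ _ v) // ?ltnSn; last by move=> x; lia.
  have := @run_incp_cons K i (outl (out σ) a) (mkseq (colf σ) v) (colf σ v)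
     (map (colf σ) (iota v.+1 (m - v.+1))) b allv.
  by rewrite size_mkseq bit_colf // ltnn; exact.
- by rewrite /opcost; nia.
Qed.

Lemma spec_dec σ i v : i < K -> cnt σ i = v.+1 -> spec (@decp K i) σ 1 tt (upd σ i v).
Proof.
move=> iK Ev; apply: spec_intro => m a b Hm.
have [sz Hc] := Hm.
have allv : all (@bit K ^~ i) (rcons (mkseq (colf σ) v) (colf σ v)).
  rewrite -cats1 all_cat /= bit_colf // Ev ltnSn !andbT.
  apply/allP => c /mapP[x]; rewrite mem_iota => /andP[_ xv] ->.
  by rewrite bit_colf // Ev; lia.
have vm : v < m by rewrite -Ev; apply: Hc.
exists m, a, b, (v.+1 * (9 * B + 30)); split.
- by apply: wf_upd => //; lia.
- by rewrite /=; lia.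
- rewrite (mkseq_split _ vm) (@mkseq_colf_upd _ _ v) // ?ltnn; last by move=> x; lia.
  have := @run_decp K i (outl (out σ) a) (mkseq (colf σ) v) (colf σ v)
     (map (colf σ) (iota v.+1 (m - v.+1))) b allv.
  rewrite size_mkseq; apply.
  case: (m - v.+1) => [|k] //= _ [<-]; rewrite bit_colf // Ev; lia.
- by rewrite /opcost; nia.
Qed.

Lemma spec_emit σ b : spec (emitp b) σ 1 tt (push [:: b] σ).
Proof.
apply: spec_intro => m a c Hm; exists m, a.-1, c, ((size (out σ)).+1 * 10); split=> //.
- by rewrite /=; lia.
- by have := run_emitp b (out σ) a (mkseq (colf σ) m) c.
- by rewrite /opcost; nia.
Qed.

Fixpoint emit_str (s : seq bool) : prog unit :=
  if s is b :: s' then emit_str s' ;; emitp b else ret tt.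

Lemma spec_emit_str s σ : spec (emit_str s) σ (size s).+1 tt (push s σ).
Proof.
elim: s => [|b s IH] /=; first by case: σ => f o; apply: spec_ret.
rewrite -addn1; apply: spec_seqp; first exact: IH.
rewrite -cat1s -push_cat; exact: spec_emit.
Qed.

Lemma spec_loop_iter (R : finType) (P : prog (option R)) (f : nat -> store) k c r σ' :
  (forall i, i < k -> spec P (f i) c None (f i.+1)) -> spec P (f k) c (Some r) σ' ->
  spec (loop P) (f 0) (k.+1 * c) r σ'.
Proof.
elim: k f => [|k IH] f H1 H2; first by rewrite mul1n; apply: spec_loop_exit.
rewrite mulSn; apply: spec_loop_step; first exact: H1.
by apply: (IH (fun i => f i.+1)) => // i ik; apply: H1.
Qed.

Inductive test :=
| TLe of nat & nat
| TZero of nat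
| TIn of nat & nat & bool.

Definition testp (t : test) (c : column) : bool :=
  match t with
  | TLe i j => bit c i ==> bit c j
  | TZero i => ~~ bit c i
  | TIn j s b => (bit c s && ~~ bit c j) ==> (bit c K && (bit c K.+1 == b))
  end.

Definition evalt (t : test) σ : bool :=
  match t with
  | TLe i j => cnt σ i <= cnt σ j
  | TZero i => cnt σ i == 0
  | TIn j s b => (cnt σ j < size z) && (nth false z (cnt σ j) == b)
  end.

(* In [TIn j s b], counter [s] is one ahead of counter [j], so that the column
   with number [cnt j] is the only one with bit [s] set and bit [j] unset. *)
Definition testok (t : test) σ : bool :=
  match t with
  | TLe i j => (i < K) && (j < K)
  | TZero i => i < K
  | TIn j s b => [&& j < K, s < K & cnt σ s == (cnt σ j).+1]
  end.

(** Each failure shows in a single column: number [cnt σ j] for [TLe] and [TIn], number 0 for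
    [TZero]. *)
Lemma all_testp t σ m : wf m σ -> testok t σ ->
  all (testp t) (mkseq (colf σ) m) = evalt t σ.
Proof.
move=> Hm; have [sz Hc] := Hm; case: t => [i j|i|j s b] /=.
- case/andP=> iK jK; apply/allP/idP => [H|H c /mapP[x xm ->]]; last first.
    by rewrite /= !bit_colf //; apply/implyP; lia.
  rewrite leqNgt; apply/negP => ji.
  have /H : colf σ (cnt σ j) \in mkseq (colf σ) m.
    by apply: map_f; rewrite mem_iota /=; have := Hc _ iK; lia.
  by rewrite /= !bit_colf // ji ltnn.
- move=> iK; apply/allP/eqP => [H|H c /mapP[x xm ->]]; last by rewrite /= bit_colf // H.
  case: (posnP (cnt σ i)) => // i0.
  have /H : colf σ 0 \in mkseq (colf σ) m.
    by apply: map_f; rewrite mem_iota /=; have := Hc _ iK; lia.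
  by rewrite /= bit_colf // i0.
case/and3P=> jK sK /eqP E; apply/allP/andP => [H|[H1 H2] c /mapP[x xm ->]].
  have /H : colf σ (cnt σ j) \in mkseq (colf σ) m.
    by apply: map_f; rewrite mem_iota /=; have := Hc _ sK; lia.
  rewrite /= (bit_colf _ _ sK) (bit_colf _ _ jK) E ltnSn ltnn /= !bit_mkcol ?ltnn ?eqxx //.
  rewrite [K.+1 < K]ltnNge leqnSn /=.
  by rewrite (gtn_eqF (ltnSn K)) => /andP.
rewrite /= (bit_colf _ _ sK) (bit_colf _ _ jK) E; apply/implyP => /andP[x1 x2].
have -> : x = cnt σ j by lia.
rewrite !bit_mkcol ?ltnn ?eqxx //.
rewrite [K.+1 < K]ltnNge leqnSn /= H1.
by rewrite (gtn_eqF (ltnSn K)).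
Qed.

Definition guard := seq test.
Definition checkg (g : guard) : prog bool := allc (fun c => all (testp^~ c) g).
Definition evalg (g : guard) σ := all (evalt^~ σ) g.
Definition guardok (g : guard) σ := all (testok^~ σ) g.

Lemma spec_checkg g σ : guardok g σ -> spec (checkg g) σ 1 (evalg g σ) σ.
Proof.
move=> ok; apply: spec_allc => m Hm.
elim: g ok => [|t g IH] /=; first by move=> _; apply/allP.
case/andP=> tok /IH; rewrite /evalg /= => <-; rewrite -(all_testp Hm tok).
by rewrite -all_predI; apply: eq_all.
Qed.

Definition forr t (body : prog unit) : prog unit :=
  loop (bind (checkg [:: TZero t]) (fun v =>
    if v then ret (Some tt) else @decp K t ;; body ;; ret None)).

(** [f v] is the store with [v] rounds to go; the value of [t] is imposed by [upd], so that [f] need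
    not record it. *)
Lemma spec_forr t body (f : nat -> store) V c : t < K ->
  (forall v, v < V -> spec body (upd (f v.+1) t v) c tt (upd (f v) t v)) ->
  spec (forr t body) (upd (f V) t V) (V.+1 * (c + 3)) tt (upd (f 0) t 0).
Proof.
move=> tK H; pose h i := upd (f (V - i)) t (V - i).
have -> : upd (f V) t V = h 0 by rewrite /h subn0.
have okz σ : guardok [:: TZero t] σ by rewrite /= tK.
apply: spec_loop_iter => [i iV|].
  have E : V - i = (V - i.+1).+1 by lia.
  apply: (@spec_le _ _ _ (1 + (1 + (c + 1)))); first lia.
  apply: spec_bind; first exact: spec_checkg.
  rewrite /evalg /= updfE E /=.
  apply: spec_seqp; first by apply: (@spec_dec _ t (V - i.+1)) => //=; rewrite updfE.
  apply: spec_seqp; last exact: spec_ret.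
  by rewrite /h E upd_upd; apply: H; lia.
apply: (@spec_le _ _ _ (1 + 1)); first lia.
apply: spec_bind; first exact: spec_checkg.
by rewrite /evalg /= /h subnn updfE /=; apply: spec_ret.
Qed.

(** The body sees [t = v] and [s = v + 1]. Values run downwards as the output is built backwards, so
    the strings appear in increasing order; the final [clear] restores [s = 0]. *)
Definition fordown t s X (body : prog unit) : prog unit :=
  set_counter t X ;; forr t (set_counter s t ;; @incp K s ;; body) ;; clear s.

Definition emits P f str n := forall o, spec P (Store f o) n tt (Store f (str ++ o)).

Lemma emits_str s f : emits (emit_str s) f s (size s).+1.
Proof. by move=> o; apply: (@spec_emit_str s (Store f o)). Qed.

Lemma emits_fordown t s X body f F c : t < K -> s < K -> X < K -> t != s ->
  f t = 0 -> f s = 0 ->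
  (forall v, v < f X -> emits body (updf (updf f t v) s v.+1) (F v) c) ->
  emits (fordown t s X body) f (flatten [seq F v | v <- iota 0 (f X)]) ((f X).+1 * (c + 7)).
Proof.
move=> tK sK XK ts t0 s0 H o; set N := f X.
(* [h v] is the situation once the values from [v] on are treated: [s] is 0 before the first round,
   and then one more than the last value treated. *)
pose h v := Store (updf f s (if v < N then v.+1 else 0))
                  (flatten [seq F w | w <- iota v (N - v)] ++ o).
apply: (@spec_le _ _ _ (1 + (N.+1 * ((1 + (1 + c)) + 3) + 1))); first lia.
apply: spec_seqp; first exact: spec_set_counter.
have -> : upd (Store f o) t N = upd (h N) t N.
  by rewrite /h /upd /= subnn ltnn (updf_id s0).
apply: spec_seqp.
  apply: spec_forr => // v vN.
  apply: spec_seqp; first exact: spec_set_counter.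
  apply: spec_seqp; first exact: spec_inc.
  have := H v vN (flatten [seq F w | w <- iota v.+1 (N - v.+1)] ++ o).
  rewrite /upd /h vN /= !updfE !updf_updf.
  rewrite !(@updfC _ s t) 1?eq_sym // !updf_updf catA.
  have -> : F v ++ flatten [seq F w | w <- iota v.+1 (N - v.+1)] =
            flatten [seq F w | w <- iota v (N - v)].
    by have -> : N - v = (N - v.+1).+1 by lia.
  exact.
have := @spec_clear (upd (h 0) t 0) s sK; rewrite /upd /h /= subn0.
by rewrite (@updfC _ s t) 1?eq_sym // updf_updf (updf_id t0) (updf_id s0).
Qed.

End Programs.

(** * Loading the input and reading off the output *)


Definition dbl (w : seq bool) : seq bool := flatten [seq [:: b; b] | b <- w].

Lemma size_dbl w : size (dbl w) = 2 * size w.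
Proof. by elim: w => //= b w; rewrite /dbl /= => ->; lia. Qed.

(** * Polynomially bounded functions *)

Definition polyb (f : nat -> nat) := exists c k, forall n, f n <= poly_bound c k n.

Lemma polyb_le f g : (forall n, f n <= g n) -> polyb g -> polyb f.
Proof. by move=> fg [c [k H]]; exists c, k => n; apply: leq_trans (H n). Qed.

Lemma polyb_const a : polyb (fun _ => a).
Proof. by exists a, 0 => n; rewrite /poly_bound muln1. Qed.

Lemma polyb_id : polyb id.
Proof. by exists 1, 1 => n; rewrite /poly_bound mul1n expn1. Qed.

Lemma polyb_add f g : polyb f -> polyb g -> polyb (fun n => f n + g n).
Proof.
case=> [c [k Hf]] [c' [k' Hg]]; exists (c + c'), (k + k') => n.
rewrite /poly_bound mulnDl; apply: leq_add.
  apply: leq_trans (Hf n) _; rewrite leq_mul2l leq_pexp2l ?orbT //; lia.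
apply: leq_trans (Hg n) _; rewrite leq_mul2l leq_pexp2l ?orbT //; lia.
Qed.

Lemma polyb_mul f g : polyb f -> polyb g -> polyb (fun n => f n * g n).
Proof.
case=> [c [k Hf]] [c' [k' Hg]]; exists (c * c'), (k + k') => n.
by rewrite /poly_bound expnD mulnACA; apply: leq_mul.
Qed.

Lemma polyb_succ f : polyb f -> polyb (fun n => (f n).+1).
Proof.
move=> H; apply: polyb_le (polyb_add H (polyb_const 1)) => n.
by rewrite addn1.
Qed.

Lemma polyb_exp f k : polyb f -> polyb (fun n => f n ^ k).
Proof.
move=> H; elim: k => [|k IH]; first exact: polyb_const.
by apply: polyb_le (polyb_mul H IH) => n; rewrite expnS.
Qed.

Section Loading.

Variable K : nat.
Hypothesis K0 : 0 < K.
Notation B := K.+2.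
Notation column := (B.-tuple bool).

(** Bit 0 is set because counter 0 starts as the length of the loaded word; bit [K] marks a column
    inside this word. *)
Definition ldcol (b : bool) : column :=
  mkcol K (fun i => if i < K then i == 0 else if i == K then true else b).

(** Each round erases one input letter and appends two copies of its column, which is the doubling
    in [enc_pair]; the blank behind the input triggers the terminator 01. *)
Definition loadbody : prog (option unit) :=
  bind (act (fun x => (x, None, if x is Some _ then MoveR else Stay)))
    (fun x : option bool =>
      if x is Some b then
        goR ;; stepR ;; goR ;; wr (ldcol b) ;; wr (ldcol b) ;;
        stepL ;; goL ;; stepL ;; goL ;; stepR ;; ret None
      else
        stepR ;; goR ;; wr (ldcol false) ;; wr (ldcol true) ;; home ;; ret (Some tt)).

(** Walking to both ends of the input only turns the blanks around it into explicit cells, as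
    [loadtape] expects. *)
Definition load : prog unit := goR ;; stepL ;; goL ;; stepR ;; loop loadbody.

Definition loadtape a v (cs : seq column) b : tape :=
  mkr (nseq a None) (map Some v ++ None :: (fl cs ++ nseq b None)).

Lemma mkr_nseq l b : mkr l (nseq b None) = mkr l (nseq b.-1.+1 None).
Proof. by case: b. Qed.

Lemma run_goR_cols L (cs : seq column) b :
  run goR (mkr (None :: L) (fl cs ++ nseq b None)) (size cs * B).+1 tt
      (zipper L cs [::] b.-1).
Proof.
rewrite /zipper -mkr_nseq -size_cells; apply: run_goR; by case: b.
Qed.

Lemma run_loadbody_some a x v cs b : exists b',
  run loadbody (loadtape a.+1 (x :: v) cs b) (40 * B * (size v + size cs + 1))
      None (loadtape a.+2 v (cs ++ [:: ldcol x; ldcol x]) b').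
Proof.
pose L := catrev (map Some v) (nseq a.+2 None).
have [b1 H1] := run_wr_nil L cs (ldcol x) b.-1.
have [b2 H2] := run_wr_nil L (rcons cs (ldcol x)) (ldcol x) b1.
exists b2.+1; apply: run_le.
  apply: (@run_bind _ _ _ _ _ 1 (Some x)); first exact: run_act.
  rewrite /= -/(map _ _) -/(cat _ _).
  apply: (@run_seqp _ _ _ _ _ (size v).+1 tt (mkr L (None :: (fl cs ++ nseq b None)))).
    exact: (@run_goR v (nseq a.+2 None)).
  apply: run_seqp; first exact: run_stepR.
  apply: run_seqp; first exact: run_goR_cols.
  apply: run_seqp; first exact: H1.
  apply: run_seqp; first exact: H2.
  set cs' := rcons _ _.
  apply: run_seqp; first exact: run_stepL.
  apply: (@run_seqp _ _ _ _ _ (size cs' * B).+1 tt (mkr L (None :: (fl cs' ++ nseq b2.+1 None)))).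
    have -> : catrev (fl cs') (None :: L) = map Some (rev (cells cs')) ++ None :: L.
      by rewrite catrevE /fl map_rev.
    have := @run_goL (rev (cells cs')) (None :: L) (nseq b2.+1 None) erefl.
    by rewrite size_rev size_cells catrevE -map_rev revK; exact.
  apply: run_seqp; first exact: run_stepL.
  apply: (@run_seqp _ _ _ _ _ (size v).+1 tt
     (Tape (nseq a.+1 None) None (map Some v ++ None :: (fl cs' ++ nseq b2.+1 None)))).
    have -> : L = map Some (rev v) ++ nseq a.+2 None by rewrite /L catrevE map_rev.
    have := @run_goL (rev v) (nseq a.+2 None) (None :: (fl cs' ++ nseq b2.+1 None)) erefl.
    by rewrite size_rev catrevE -map_rev revK; exact.
  apply: run_seqp.
    exact: (run_stepR (nseq a.+1 None) (None :: (map Some v ++ None :: (fl cs' ++ nseq b2.+1 None)))).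
  have -> : cs ++ [:: ldcol x; ldcol x] = cs' by rewrite /cs' -!cats1 -catA.
  exact: run_ret.
by rewrite !size_rcons ?size_tuple; nia.
Qed.

Lemma run_loadbody_none a cs b : exists b',
  run loadbody (loadtape a [::] cs b) (40 * B * (size cs + 1))
      (Some tt) (zipper (nseq a None) [::] (cs ++ [:: ldcol false; ldcol true]) b').
Proof.
pose L := nseq a (@None bool).
have [b1 H1] := run_wr_nil L cs (ldcol false) b.-1.
have [b2 H2] := run_wr_nil L (rcons cs (ldcol false)) (ldcol true) b1.
exists b2; apply: run_le.
  apply: (@run_bind _ _ _ _ _ 1 None (loadtape a [::] cs b)); first exact: run_act.
  apply: run_seqp; first exact: run_stepR.
  apply: run_seqp; first exact: run_goR_cols.
  apply: run_seqp; first exact: H1.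
  apply: run_seqp; first exact: H2.
  apply: run_seqp; first exact: run_home.
  have -> : cs ++ [:: ldcol false; ldcol true] =
    rcons (rcons cs (ldcol false)) (ldcol true) ++ [::] by rewrite -!cats1 -!catA.
  exact: run_ret.
by rewrite !size_rcons ?size_tuple; nia.
Qed.

Lemma run_loadloop a v cs b : exists a' b',
  run (loop loadbody) (loadtape a.+1 v cs b)
      ((size v).+1 * (40 * B * (3 * size v + size cs + 1)))
      tt (zipper (nseq a' None) [::] (cs ++ map ldcol (dbl v) ++ [:: ldcol false; ldcol true]) b').
Proof.
elim: v a cs b => [|x v IH] a cs b.
  have [b' H] := run_loadbody_none a.+1 cs b; exists a.+1, b'.
  apply: run_loop_exit; apply: run_le H _; rewrite /=; nia.
have [b1 H1] := run_loadbody_some a x v cs b.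
have [a' [b' H]] := IH a.+1 (cs ++ [:: ldcol x; ldcol x]) b1.
exists a', b'; apply: run_le.
  apply: run_loop_step; first exact: H1.
  have -> : cs ++ map ldcol (dbl (x :: v)) ++ [:: ldcol false; ldcol true] =
     (cs ++ [:: ldcol x; ldcol x]) ++ map ldcol (dbl v) ++ [:: ldcol false; ldcol true].
    by rewrite -catA.
  exact: H.
by rewrite size_cat /=; nia.
Qed.

(** The part of [enc_pair w u] preceding the certificate; it becomes the word [z] of the programs
    and of the game. *)
Definition pre w := dbl w ++ [:: false; true].

Definition store0 w := Store (fun i => if i == 0 then size (pre w) else 0) [::].

Lemma size_pre w : size (pre w) = 2 * size w + 2.
Proof. by rewrite size_cat size_dbl. Qed.

Definition tape_of (w : seq bool) : tape := mkr [::] (map Some w).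

Lemma run_load w : exists2 t, Rep K (pre w) (store0 w) (size (pre w)) t &
  run load (tape_of w) (200 * B * (size w).+1 ^ 2) tt t.
Proof.
have [a' [b' H]] := run_loadloop 0 w [::] 0.
exists (zipper (nseq a' None) [::] (map ldcol (dbl w) ++ [:: ldcol false; ldcol true]) b').
  split; first by split=> //= i; case: eqP.
  exists a', b'; rewrite /outl /=; congr zipper.
  have -> : map ldcol (dbl w) ++ [:: ldcol false; ldcol true] = map ldcol (pre w).
    by rewrite /pre map_cat.
  apply: (@eq_from_nth _ (col0 K)); first by rewrite size_mkseq size_map.
  move=> i; rewrite size_map => iz; rewrite nth_mkseq // (nth_map false) //.
  apply: columnP => j jB; rewrite !bit_mkcol //=.
  by case: ifP => // jK; case: eqP; rewrite ?iz.
apply: run_le.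
  apply: run_seqp.
    have := @run_goR w [::] [::] erefl; rewrite cats0; exact.
  apply: run_seqp; first exact: run_stepL.
  apply: (@run_seqp _ _ _ _ _ (size w).+1 tt (Tape [::] None (map Some w ++ [:: None]))).
    have -> : catrev (map Some w) [::] = map Some (rev w) ++ [::] by rewrite catrevE map_rev.
    have := @run_goL (rev w) [::] [:: None] erefl.
    by rewrite size_rev catrevE -map_rev revK; exact.
  apply: run_seqp; first exact: (run_stepR [::] (None :: map Some w ++ [:: None])).
  exact: H.
by rewrite -mulnn /=; nia.
Qed.

(** Puts the head on the first output letter, where [tm_output] starts reading; the separator ends
    the word. *)
Definition finish : prog unit := stepL ;; stepL ;; goL ;; stepR.

Lemma run_finish o a (cs : seq column) b : exists l r,
  run finish (zipper (outl o a) [::] cs b) (size o + 5) tt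
      (mkr l (map Some o ++ None :: r)).
Proof.
rewrite /zipper /=; set s := fl cs ++ _.
have Es : head None s :: behead s = s by rewrite /s; case: (fl cs).
exists (None :: behead (nseq a None)), s.
apply: run_le.
  apply: run_seqp; first exact: run_stepL.
  rewrite Es mklE.
  apply: run_seqp; first exact: run_stepL.
  apply: run_seqp.
    by apply: run_goL; case: (a).
  rewrite /= catrevE -map_rev revK.
  exact: (run_stepR (behead (nseq a None)) (None :: map Some o ++ None :: s)).
by rewrite size_rev; lia.
Qed.

Lemma read_word_map_Some (o : seq bool) r : read_word (map Some o ++ None :: r) = o.
Proof. by elim: o => //= x o ->. Qed.

Lemma poly_time_of_spec (P : prog unit) (N : nat -> nat) (f : seq bool -> seq bool) :
  polyb N ->
  (forall w, exists2 σ, out σ = f w & spec K (pre w) P (store0 w) (N (size w)) tt σ) ->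
  poly_time_computable f.
Proof.
move=> HN HP.
(* The summands pay for loading, for the program, and for walking back over an output of length at
   most [2 * n + 2 + N n]. *)
pose T n := 200 * B * n.+1 ^ 2 + (N n * (opcost K * (2 * n + 2 + N n).+1) + (2 * n + 2 + N n + 5)).
have [c [k HT]] : polyb T.
  rewrite /T; do ?[exact: HN | exact: polyb_id | exact: polyb_const |
    apply: polyb_add | apply: polyb_mul | apply: polyb_succ | apply: polyb_exp].
exists (tm_of (load ;; P ;; finish)), c, k => w.
have [t1 R1 r1] := run_load w.
have [σ <- HPw] := HP w.
have [m2 [t2 [[_ [a [b Et2]]] s2 r2]]] := HPw _ _ R1.
have [l [r r3]] := run_finish (out σ) a (mkseq (colf K (pre w) σ) m2) b.
rewrite -Et2 in r3.
have [n' len' En'] := tm_of_run (run_seqp r1 (run_seqp r2 r3)).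
exists n'; split.
- apply: leq_trans len' _; apply: leq_trans (HT _).
  rewrite /T leq_add2l size_pre /= addn0; apply: leq_add => //.
  by move: s2; rewrite size_pre /=; lia.
- have -> : tm_init (tm_of (load;; P;; finish)) w =
    @Config (tm_of (load ;; P ;; finish)) (inl (pstart (load;; P;; finish))) (tleft (tape_of w)) (tcur (tape_of w)) (tright (tape_of w)).
    by case: (w).
  rewrite En'; split=> //.
  rewrite /tm_output -[RHS](read_word_map_Some _ r).
  by case: (out σ).
Qed.

End Loading.

(** * The game *)


(* The counters.  cL: length of the word z preceding the certificate; cQ: the
   position where the certificate must have ended; cX: the width W; cK: its binary
   logarithm.  For each player, t and j are the coordinates of the position, s and
   u their successors, so that t + 1 = t' can be tested without arithmetic. *)
Notation cL := 0 (only parsing).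
Notation cN := 1 (only parsing).
Notation cQ := 2 (only parsing).
Notation cX := 3 (only parsing).
Notation cK := 4 (only parsing).
Notation t1 := 5 (only parsing).
Notation s1 := 6 (only parsing).
Notation j1 := 7 (only parsing).
Notation u1 := 8 (only parsing).
Notation t2 := 9 (only parsing).
Notation s2 := 10 (only parsing).
Notation j2 := 11 (only parsing).
Notation u2 := 12 (only parsing).
Notation t3 := 13 (only parsing).
Notation s3 := 14 (only parsing).
Notation j3 := 15 (only parsing).
Notation u3 := 16 (only parsing).
Notation tA := 17 (only parsing).
Notation tB := 18 (only parsing).
Notation cB := 19 (only parsing).
Notation cH := 20 (only parsing).
Notation nctr := 21 (only parsing).

Definition setpos f t s j u x y := updf (updf (updf (updf f t x) s x.+1) j y) u y.+1.

Definition posf f x1 y1 x2 y2 x3 y3 :=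
  setpos (setpos (setpos f t1 s1 j1 u1 x1 y1) t2 s2 j2 u2 x2 y2) t3 s3 j3 u3 x3 y3.

Definition outcome := 'I_8.
Definition rule := (guard * outcome)%type.

Definition firstrule z (l : seq rule) f : option outcome :=
  ohead [seq r.2 | r <- l & evalg z r.1 (Store f [::])].

Section Game.

Variable M : TM.
Notation Q := (tm_state M).

(** [AH] is the state with the scanned symbol, [AL] and [AR] are the cells on either side.
    [AMore]/[AEnd] and [AZero]/[AOne] are the two binary choices made per certificate cell, the
    first option belonging to player 1 and the second to player 2; primed atoms carry the chosen
    letter to player 3 and from there back. [AS] and [AF] are constants, [AP] the elements of the
    block. *)
Inductive atom :=
| AH of option Q & option bool
| AL of option bool
| AR of option bool
| AMore | AEnd | AZero | AOne | AZero' | AOne' | AS | AF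
| AP of bool.

(* The control state [None] precedes the start state: its only step moves the
   head from the cell left of the input onto the input, so that the whole input
   initially lies to the right of the head. *)
Definition nxt (q : option Q) (s : option bool) : option Q * option bool * move :=
  match q with
  | None => (Some (tm_start M), None, MoveR)
  | Some q => if tm_halt q then (Some q, s, Stay)
              else let: (q', s', mv) := tm_delta q s in (Some q', s', mv)
  end.

Definition accq (q : option Q) : bool := if q is Some q then tm_accept q else false.

Definition eqg i j : guard := [:: TLe i j; TLe j i].
Definition stepg : guard := eqg t1 t2 ++ eqg s1 t3.

(** The clauses give, in order, the transitions, the contradiction if the state at time [W - 1] does
    not accept, the initial row, and the certificate. A clause with a single real premise repeats it
    or is padded with [AS]. Conclusions [AH] leave [j3] free, so head facts hold at every [j]. *)
Definition hornrule (a1 a2 a3 : atom) : option guard :=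
  match a1, a2, a3 with
  | AH q s, AL a, AH q' s' =>
    let: (q1, w1, mv) := nxt q s in
    if mv is MoveL then
      if (q' == q1) && (s' == a) then Some (stepg ++ [:: TZero j2]) else None
    else None
  | AH q s, AR a, AH q' s' =>
    let: (q1, w1, mv) := nxt q s in
    if mv is MoveR then
      if (q' == q1) && (s' == a) then Some (stepg ++ [:: TZero j2]) else None
    else None
  | AH q s, AH q0 s0, AH q' s' =>
    let: (q1, w1, mv) := nxt q s in
    if mv is Stay then
      if [&& q0 == q, s0 == s, q' == q1 & s' == w1] then Some stepg else None
    else None
  | AH q s, AH q0 s0, AL a =>
    let: (q1, w1, mv) := nxt q s in
    if mv is MoveR then
      if [&& q0 == q, s0 == s & a == w1] then Some (stepg ++ [:: TZero j3]) else None
    else None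
  | AH q s, AH q0 s0, AR a =>
    let: (q1, w1, mv) := nxt q s in
    if mv is MoveL then
      if [&& q0 == q, s0 == s & a == w1] then Some (stepg ++ [:: TZero j3]) else None
    else None
  | AH q s, AL a, AL a' =>
    if a == a' then
      Some (stepg ++ match (nxt q s).2 with
                     | MoveL => eqg j2 u3
                     | MoveR => eqg u2 j3
                     | Stay => eqg j2 j3
                     end)
    else None
  | AH q s, AR a, AR a' =>
    if a == a' then
      Some (stepg ++ match (nxt q s).2 with
                     | MoveL => eqg u2 j3
                     | MoveR => eqg j2 u3
                     | Stay => eqg j2 j3
                     end)
    else None
  | AH q s, AH q0 s0, AF =>
    if [&& q0 == q, s0 == s & ~~ accq q] then Some (eqg t1 t2 ++ eqg s1 cX) else None
  | AS, AS, AH None None => Some [:: TZero t3]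
  | AS, AS, AL None => Some [:: TZero t3]
  | AS, AS, AR None => Some [:: TZero t3; TLe cQ j3]
  | AS, AS, AR (Some b) => Some [:: TZero t3; TIn j3 u3 b]
  | AS, AEnd, AR None => Some (TZero t3 :: eqg j2 j3)
  | AR None, AR None, AR None =>
    Some (TZero t3 :: eqg t1 t3 ++ eqg t2 t3 ++ eqg j1 j2 ++ eqg u1 j3)
  | AS, AOne, AOne' => Some (eqg j2 j3)
  | AZero, AS, AZero' => Some (eqg j1 j3)
  | AMore, AOne', AR (Some true) => Some (TZero t3 :: eqg j1 j3 ++ eqg j2 j3)
  | AMore, AZero', AR (Some false) => Some (TZero t3 :: eqg j1 j3 ++ eqg j2 j3)
  | _, _, _ => None
  end.

(** The conclusions that are used again as premises, and so have to be copied from player 3 to the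
    others. *)
Definition derived (a : atom) : bool :=
  match a with AH _ _ | AL _ | AR _ | AZero' | AOne' => true | _ => false end.

(** Supplies atoms with a decidable equality and an enumeration, by which positions get numbered. *)
Definition atom_code : finType := ((option Q * option bool) + (bool * option bool) + 'I_10)%type.

Definition atom_enc (a : atom) : atom_code :=
  match a with
  | AH q s => inl (inl (q, s))
  | AL s => inl (inr (true, s))
  | AR s => inl (inr (false, s))
  | AMore => inr (inord 0) | AEnd => inr (inord 1) | AZero => inr (inord 2)
  | AOne => inr (inord 3) | AZero' => inr (inord 4) | AOne' => inr (inord 5)
  | AS => inr (inord 6) | AF => inr (inord 7)
  | AP b => inr (inord (if b then 8 else 9))
  end.

Definition atom_dec (c : atom_code) : atom :=
  match c with
  | inl (inl (q, s)) => AH q s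
  | inl (inr (true, s)) => AL s
  | inl (inr (false, s)) => AR s
  | inr i => match nat_of_ord i with
             | 0 => AMore | 1 => AEnd | 2 => AZero | 3 => AOne | 4 => AZero'
             | 5 => AOne' | 6 => AS | 7 => AF | 8 => AP true | _ => AP false
             end
  end.

Lemma atom_encK : cancel atom_enc atom_dec.
Proof. by case=> [q s|s|s|||||||||[]] //=; rewrite inordK. Qed.

(* All guards of [linkrule] have outcome 1, which means "true" for players 1 and 2
   and "false" for player 3: a fact that is true for player 3 is true for all, and
   at least one of the two options of a choice is taken. *)
Definition linkrule (a1 a2 a3 : atom) : option guard :=
  match a1, a2, a3 with
  | AMore, AEnd, AF => Some (eqg t1 t2 ++ eqg j1 j2)
  | AZero, AOne, AF => Some (eqg t1 t2 ++ eqg j1 j2)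
  | a, AS, a' => if derived a && (atom_enc a == atom_enc a') then Some (eqg t1 t3 ++ eqg j1 j3) else None
  | AS, a, a' => if derived a && (atom_enc a == atom_enc a') then Some (eqg t2 t3 ++ eqg j2 j3) else None
  | _, _, _ => None
  end.

(* Six values for the six [AP] elements cover five distinct outcomes, but if both
   [AP] elements of one player take value 2, four values are left for five outcomes. *)
Definition blockrule (a1 a2 a3 : atom) : option nat :=
  match a1, a2, a3 with
  | AP false, AP false, AP false => Some 3
  | AP true, AP true, AP true => Some 4
  | AP false, AP true, AP false => Some 5
  | AP false, AP false, AP true => Some 6
  | AP true, AP false, AP false => Some 7
  | AS, AP _, AP _ => Some 2
  | AP _, AS, AP _ => Some 2
  | AP _, AP _, AF => Some 2
  | _, _, _ => None
  end.

Definition rules (a1 a2 a3 : atom) : seq rule :=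
  (if hornrule a1 a2 a3 is Some g then [:: (g, inord 0 : outcome)] else [::]) ++
  (if linkrule a1 a2 a3 is Some g then [:: (g, inord 1 : outcome)] else [::]) ++
  (if blockrule a1 a2 a3 is Some n then [:: ([::], inord n : outcome)] else [::]).

(** A configuration seen from the head; half tapes are functions, so that no step has to extend a
    list. *)
Record row := Row {
  row_q : option Q; row_s : option bool;
  row_l : nat -> option bool; row_r : nat -> option bool }.

Definition rstep (c : row) : row :=
  let: (q, w, mv) := nxt (row_q c) (row_s c) in
  match mv with
  | Stay => Row q w (row_l c) (row_r c)
  | MoveL => Row q (row_l c 0) (fun j => row_l c j.+1)
                 (fun j => if j is j'.+1 then row_r c j' else w)
  | MoveR => Row q (row_r c 0) (fun j => if j is j'.+1 then row_l c j' else w)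
                 (fun j => row_r c j.+1)
  end.

Definition letter (v : seq bool) j : option bool := nth None (map Some v) j.

Definition row0 (v : seq bool) : row := Row None None (fun _ => None) (letter v).

Definition trace v n := iter n rstep (row0 v).

Variables (z : seq bool) (f0 : nat -> nat) (W Qb : nat).
Hypotheses (W0 : 0 < W) (f0W : f0 cX = W) (f0Q : f0 cQ = Qb) (zQ : size z <= Qb).

Definition sat (g1 g2 g3 : nat -> nat -> atom -> outcome) :=
  forall x1 y1 x2 y2 x3 y3 a1 a2 a3 o,
    x1 < W -> y1 < W -> x2 < W -> y2 < W -> x3 < W -> y3 < W ->
    firstrule z (rules a1 a2 a3) (posf f0 x1 y1 x2 y2 x3 y3) = Some o ->
    [\/ g1 x1 y1 a1 = o, g2 x2 y2 a2 = o | g3 x3 y3 a3 = o].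

Definition acceptable := exists2 u, size u <= Qb - size z & accq (row_q (trace (z ++ u) W.-1)).

(** * Soundness: an assignment yields an accepted certificate *)

Section Soundness.

Variables g1 g2 g3 : nat -> nat -> atom -> outcome.
Hypothesis Hsat : sat g1 g2 g3.

Notation N1 x y a := (nat_of_ord (g1 x y a)).
Notation N2 x y a := (nat_of_ord (g2 x y a)).
Notation N3 x y a := (nat_of_ord (g3 x y a)).

Lemma sat_nat x1 y1 x2 y2 x3 y3 a1 a2 a3 n : n < 8 ->
  x1 < W -> y1 < W -> x2 < W -> y2 < W -> x3 < W -> y3 < W ->
  firstrule z (rules a1 a2 a3) (posf f0 x1 y1 x2 y2 x3 y3) = Some (inord n) ->
  [\/ N1 x1 y1 a1 = n, N2 x2 y2 a2 = n | N3 x3 y3 a3 = n].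
Proof.
move=> n8 h1 h2 h3 h4 h5 h6 /Hsat -/(_ h1 h2 h3 h4 h5 h6).
by case=> ->; [constructor 1|constructor 2|constructor 3]; rewrite inordK.
Qed.

Lemma sat_block x1 y1 x2 y2 x3 y3 a1 a2 a3 n :
  x1 < W -> y1 < W -> x2 < W -> y2 < W -> x3 < W -> y3 < W ->
  hornrule a1 a2 a3 = None -> linkrule a1 a2 a3 = None ->
  blockrule a1 a2 a3 = Some n -> n < 8 ->
  [\/ N1 x1 y1 a1 = n, N2 x2 y2 a2 = n | N3 x3 y3 a3 = n].
Proof.
by move=> h1 h2 h3 h4 h5 h6 e1 e2 e3 n8; apply: sat_nat => //; rewrite /rules e1 e2 e3.
Qed.

Lemma sat_link x1 y1 x2 y2 x3 y3 a1 a2 a3 g :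
  x1 < W -> y1 < W -> x2 < W -> y2 < W -> x3 < W -> y3 < W ->
  hornrule a1 a2 a3 = None -> linkrule a1 a2 a3 = Some g ->
  evalg z g (Store (posf f0 x1 y1 x2 y2 x3 y3) [::]) ->
  [\/ N1 x1 y1 a1 = 1, N2 x2 y2 a2 = 1 | N3 x3 y3 a3 = 1].
Proof.
move=> h1 h2 h3 h4 h5 h6 e1 e2 ev; apply: sat_nat => //.
by rewrite /rules e1 e2 /firstrule /= ev.
Qed.

Lemma sat_horn x1 y1 x2 y2 x3 y3 a1 a2 a3 g :
  x1 < W -> y1 < W -> x2 < W -> y2 < W -> x3 < W -> y3 < W ->
  hornrule a1 a2 a3 = Some g ->
  evalg z g (Store (posf f0 x1 y1 x2 y2 x3 y3) [::]) ->
  N1 x1 y1 a1 <> 0 -> N2 x2 y2 a2 <> 0 -> N3 x3 y3 a3 = 0.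
Proof.
move=> h1 h2 h3 h4 h5 h6 e1 ev n1 n2.
suff: [\/ N1 x1 y1 a1 = 0, N2 x2 y2 a2 = 0 | N3 x3 y3 a3 = 0] by case.
by apply: sat_nat => //; rewrite /rules e1 /firstrule /= ev.
Qed.

Lemma or3E (P1 P2 P3 : Prop) : [\/ P1, P2 | P3] <-> P1 \/ P2 \/ P3.
Proof.
split; first by case=> h; [left | right; left | right; right].
by case=> [h|[h|h]]; [constructor 1 | constructor 2 | constructor 3].
Qed.

Definition blocksat (x y w : bool -> nat) :=
  [/\ x false = 3 \/ y false = 3 \/ w false = 3, x true = 4 \/ y true = 4 \/ w true = 4,
      x false = 5 \/ y true = 5 \/ w false = 5, x false = 6 \/ y false = 6 \/ w true = 6 &
      x true = 7 \/ y false = 7 \/ w false = 7].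

Lemma blocksat_noncst x y w : blocksat x y w ->
  [/\ ~ (forall b, x b = 2), ~ (forall b, y b = 2) & ~ (forall b, w b = 2)].
Proof.
case=> B1 B2 B3 B4 B5; split=> H; move: (H true) (H false) => ht hf;
  rewrite ?ht ?hf in B1 B2 B3 B4 B5.
- by case: B1 => [//|[h1|h1]]; case: B2 => [//|[h2|h2]]; case: B3 => [//|[h3|h3]];
    case: B4 => [//|[h4|h4]]; case: B5 => [//|[h5|h5]]; congruence.
- by case: B1 => [h1|[//|h1]]; case: B2 => [h2|[//|h2]]; case: B3 => [h3|[//|h3]];
    case: B4 => [h4|[//|h4]]; case: B5 => [h5|[//|h5]]; congruence.
- by case: B1 => [h1|[h1|//]]; case: B2 => [h2|[h2|//]]; case: B3 => [h3|[h3|//]];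
    case: B4 => [h4|[h4|//]]; case: B5 => [h5|[h5|//]]; congruence.
Qed.

(** If a position to be forced missed the value 2, every pair of block elements of the other two
    players would have to provide it; one player would then take it twice, against
    [blocksat_noncst]. *)
Lemma two_cst (y w : bool -> nat) : (forall b b', y b = 2 \/ w b' = 2) ->
  (forall b, y b = 2) \/ (forall b, w b = 2).
Proof.
move=> H; have [/forallP h|/forallPn[b /eqP nb]] := boolP [forall b, y b == 2].
  by left=> b; apply/eqP.
by right=> b'; case: (H b b').
Qed.

Lemma block_nat :
  blocksat (fun b => N1 0 0 (AP b)) (fun b => N2 0 0 (AP b)) (fun b => N3 0 0 (AP b)).
Proof. by split; apply/or3E; apply: sat_block. Qed.

Lemma forceS1 x y : x < W -> y < W -> N1 x y AS = 2.
Proof.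
move=> xW yW; case: (N1 x y AS =P 2) => // NS.
have H b b' : N2 0 0 (AP b) = 2 \/ N3 0 0 (AP b') = 2.
  have: [\/ N1 x y AS = 2, N2 0 0 (AP b) = 2 | N3 0 0 (AP b') = 2] by apply: sat_block.
  by case; [|left|right].
have [n1 n2 n3] := blocksat_noncst block_nat.
by case: (two_cst H) => [/n2|/n3].
Qed.

Lemma forceS2 x y : x < W -> y < W -> N2 x y AS = 2.
Proof.
move=> xW yW; case: (N2 x y AS =P 2) => // NS.
have H b b' : N1 0 0 (AP b) = 2 \/ N3 0 0 (AP b') = 2.
  have: [\/ N1 0 0 (AP b) = 2, N2 x y AS = 2 | N3 0 0 (AP b') = 2].
    by apply: sat_block => //; case: b.
  by case; [left| |right].
have [n1 n2 n3] := blocksat_noncst block_nat.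
by case: (two_cst H) => [/n1|/n3].
Qed.

Lemma forceF3 x y : x < W -> y < W -> N3 x y AF = 2.
Proof.
move=> xW yW; case: (N3 x y AF =P 2) => // NS.
have H b b' : N1 0 0 (AP b) = 2 \/ N2 0 0 (AP b') = 2.
  have: [\/ N1 0 0 (AP b) = 2, N2 0 0 (AP b') = 2 | N3 x y AF = 2].
    by apply: sat_block => //; case: b; case: b'.
  by case; [left|right|].
have [n1 n2 n3] := blocksat_noncst block_nat.
by case: (two_cst H) => [/n1|/n2].
Qed.

Definition fact x y a := N3 x y a = 0.

(** The link profile has outcome 1, while player 2 is held at 2 by [AS] and player 3 takes 0, so
    player 1 must take 1. *)
Lemma fact1 x y a : x < W -> y < W -> derived a -> fact x y a -> N1 x y a <> 0.
Proof.
move=> xW yW da f3.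
have : [\/ N1 x y a = 1, N2 x y AS = 1 | N3 x y a = 1].
  apply: (@sat_link x y x y x y a AS a (eqg t1 t3 ++ eqg j1 j3)) => //.
  - by case: a da {f3} => // -[].
  - by case: a da {f3} => //= *; rewrite eqxx.
  - by rewrite /evalg /= /posf /setpos /updf /= !leqnn.
by case=> [->||] //; rewrite ?forceS2 // f3.
Qed.

Lemma fact2 x y a : x < W -> y < W -> derived a -> fact x y a -> N2 x y a <> 0.
Proof.
move=> xW yW da f3.
have : [\/ N1 x y AS = 1, N2 x y a = 1 | N3 x y a = 1].
  apply: (@sat_link x y x y x y AS a a (eqg t2 t3 ++ eqg j2 j3)) => //.
  - by case: a da {f3} => //.
  - by case: a da {f3} => //= *; rewrite eqxx.
  - by rewrite /evalg /= /posf /setpos /updf /= !leqnn.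
by case=> [|->|] //; rewrite ?forceS1 // f3.
Qed.

Lemma fact_init x y a g : x < W -> y < W -> hornrule AS AS a = Some g ->
  evalg z g (Store (posf f0 0 0 0 0 x y) [::]) -> fact x y a.
Proof. by move=> xW yW e ev; apply: (sat_horn _ _ _ _ _ _ e ev) => //; rewrite ?forceS1 ?forceS2. Qed.

(** Induction on time. A cell may come from cell [j.+1] of the previous row, and coordinates stay
    below [W], hence the shrinking range [n + j < W]. A head fact needs only cell 0 of that row. *)
Lemma trace_facts v : (forall j, j < W -> fact 0 j (AR (letter v j))) ->
  forall n, n < W -> let c := trace v n in
  [/\ forall j, j < W -> fact n j (AH (row_q c) (row_s c)),
      forall j, n + j < W -> fact n j (AL (row_l c j)) &
      forall j, n + j < W -> fact n j (AR (row_r c j))].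
Proof.
move=> Hr; elim=> [|n IH] nW.
  split=> j jW; [|apply: fact_init; try done|exact: Hr].
  by apply: fact_init.
have nW' : n < W by lia.
have [IHq IHl IHr] := IH nW'; move=> {IH} /=.
move: (trace v n) IHq IHl IHr => c IHq IHl IHr.
rewrite /rstep; case E: (nxt (row_q c) (row_s c)) => [[q w] mv].
have H1 j : j < W -> N1 n j (AH (row_q c) (row_s c)) <> 0.
  by move=> jW; apply: fact1 => //; apply: IHq.
have H2 j : j < W -> N2 n j (AH (row_q c) (row_s c)) <> 0.
  by move=> jW; apply: fact2 => //; apply: IHq.
have L2 j : n + j < W -> N2 n j (AL (row_l c j)) <> 0.
  by move=> jW; apply: fact2 => //; [lia | apply: IHl].
have R2 j : n + j < W -> N2 n j (AR (row_r c j)) <> 0.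
  by move=> jW; apply: fact2 => //; [lia | apply: IHr].
have fire x2 y2 x3 y3 a2 a3 g : hornrule (AH (row_q c) (row_s c)) a2 a3 = Some g ->
    x2 < W -> y2 < W -> x3 < W -> y3 < W -> N2 x2 y2 a2 <> 0 ->
    evalg z g (Store (posf f0 n 0 x2 y2 x3 y3) [::]) -> fact x3 y3 a3.
  by move=> e h1 h2 h3 h4 n2 ev; apply: (sat_horn _ _ _ _ _ _ e ev) => //; apply: H1.
(* Nine cases: head, left cells and right cells for each of [MoveL], [MoveR] and [Stay]. *)
case: mv E => E; split=> j jW /=.
- apply: (fire n 0 n.+1 j (AL (row_l c 0))) => //.
  + by rewrite /= E !eqxx.
  + by apply: L2; rewrite addn0.
  + by rewrite /evalg /= /posf /setpos /updf /= !leqnn.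
- apply: (fire n j.+1 n.+1 j (AL (row_l c j.+1))); try lia.
  + by rewrite /= E !eqxx.
  + by apply: L2; lia.
  + by rewrite /evalg /= /posf /setpos /updf /= !leqnn.
(* Cell 0 on the right is the symbol just written; the others are shifted. *)
- case: j jW => [|j] jW.
  + apply: (fire n 0 n.+1 0 (AH (row_q c) (row_s c))) => //.
    * by rewrite /= E !eqxx.
    * exact: H2.
    * by rewrite /evalg /= /posf /setpos /updf /= !leqnn.
  + apply: (fire n j n.+1 j.+1 (AR (row_r c j))); try lia.
    * by rewrite /= E !eqxx.
    * by apply: R2; lia.
    * by rewrite /evalg /= /posf /setpos /updf /= !leqnn.
- apply: (fire n 0 n.+1 j (AR (row_r c 0))) => //.
  + by rewrite /= E !eqxx.
  + by apply: R2; rewrite addn0.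
  + by rewrite /evalg /= /posf /setpos /updf /= !leqnn.
- case: j jW => [|j] jW.
  + apply: (fire n 0 n.+1 0 (AH (row_q c) (row_s c))) => //.
    * by rewrite /= E !eqxx.
    * exact: H2.
    * by rewrite /evalg /= /posf /setpos /updf /= !leqnn.
  + apply: (fire n j n.+1 j.+1 (AL (row_l c j))); try lia.
    * by rewrite /= E !eqxx.
    * by apply: L2; lia.
    * by rewrite /evalg /= /posf /setpos /updf /= !leqnn.
- apply: (fire n j.+1 n.+1 j (AR (row_r c j.+1))); try lia.
  + by rewrite /= E !eqxx.
  + by apply: R2; lia.
  + by rewrite /evalg /= /posf /setpos /updf /= !leqnn.
- apply: (fire n 0 n.+1 j (AH (row_q c) (row_s c))) => //.
  + by rewrite /= E !eqxx.
  + exact: H2.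
  + by rewrite /evalg /= /posf /setpos /updf /= !leqnn.
- apply: (fire n j n.+1 j (AL (row_l c j))); try lia.
  + by rewrite /= E !eqxx.
  + by apply: L2; lia.
  + by rewrite /evalg /= /posf /setpos /updf /= !leqnn.
- apply: (fire n j n.+1 j (AR (row_r c j))); try lia.
  + by rewrite /= E !eqxx.
  + by apply: R2; lia.
  + by rewrite /evalg /= /posf /setpos /updf /= !leqnn.
Qed.

(** A non-accepting state at the last time would give [AF] the value 0 for player 3, against the
    forced value 2. *)
Lemma acc_of_sat v : (forall j, j < W -> fact 0 j (AR (letter v j))) ->
  accq (row_q (trace v W.-1)).
Proof.
move=> Hr; have W1 : W.-1 < W by lia.
have [Hq _ _] := trace_facts Hr W1.
apply: contraT => nacc.
have := forceF3 (x := 0) (y := 0) W0 W0.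
suff -> : N3 0 0 AF = 0 by [].
apply: (@sat_horn W.-1 0 W.-1 0 0 0 (AH (row_q (trace v W.-1)) (row_s (trace v W.-1))) (AH (row_q (trace v W.-1)) (row_s (trace v W.-1)))) => //.
- by rewrite /= !eqxx nacc.
- by rewrite /evalg /= /posf /setpos /updf /= f0W; lia.
- by apply: fact1 => //; apply: Hq.
- by apply: fact2 => //; apply: Hq.
Qed.

Definition ended j := N2 0 j AEnd != 0.
Definition guess j := N2 0 j AOne != 0.
(** If player 2 never declares the end, [find] returns the full length [Qb - size z], the longest
    certificate allowed; the test against [W] keeps to existing positions. *)
Definition stop := find (fun i => (size z + i < W) && ended (size z + i)) (iota 0 (Qb - size z)).
Definition guessed := mkseq (fun i => guess (size z + i)) stop.

(** As [AEnd] is false, the first choice makes [AMore] true; the second makes [AOne] or [AZero]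
    true. Both may hold, and then the letter 1 is preferred. *)
Lemma choose_bit j : j < W -> ~~ ended j -> fact 0 j (AR (Some (guess j))).
Proof.
move=> jW /negPn /eqP ne.
have more : N1 0 j AMore <> 0.
  have : [\/ N1 0 j AMore = 1, N2 0 j AEnd = 1 | N3 0 j AF = 1].
    apply: (@sat_link 0 j 0 j 0 j) => //=.
    by rewrite /evalg /= /posf /setpos /updf /= !leqnn.
  by case=> [->||] //; rewrite ?ne ?forceF3.
have zo : [\/ N1 0 j AZero = 1, N2 0 j AOne = 1 | N3 0 j AF = 1].
  apply: (@sat_link 0 j 0 j 0 j) => //=.
  by rewrite /evalg /= /posf /setpos /updf /= !leqnn.
rewrite /guess; case: eqP => /= o2.
  have z1 : N1 0 j AZero <> 0 by case: zo => [->||] //; rewrite ?o2 ?forceF3.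
  apply: (@sat_horn 0 j 0 j 0 j AMore AZero') => //.
    by rewrite /evalg /= /posf /setpos /updf /= !leqnn.
  apply: fact2 => //; apply: (@sat_horn 0 j 0 j 0 j AZero AS) => //; last by rewrite forceS2.
  by rewrite /evalg /= /posf /setpos /updf /= !leqnn.
apply: (@sat_horn 0 j 0 j 0 j AMore AOne') => //.
  by rewrite /evalg /= /posf /setpos /updf /= !leqnn.
apply: fact2 => //; apply: (@sat_horn 0 j 0 j 0 j AS AOne) => //; last by rewrite forceS1.
by rewrite /evalg /= /posf /setpos /updf /= !leqnn.
Qed.

Lemma guessed_row j : j < W -> fact 0 j (AR (letter (z ++ guessed) j)).
Proof.
move=> jW; rewrite /letter; have [jz|zj] := ltnP j (size z).
  rewrite (nth_map false) ?size_cat; last by lia.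
  rewrite nth_cat jz; apply: fact_init => //.
  by rewrite /evalg /= /posf /setpos /updf /= jz eqxx.
have [js|sj] := ltnP (j - size z) stop.
  rewrite (nth_map false) ?size_cat ?size_mkseq; last by lia.
  rewrite nth_cat ltnNge zj /= nth_mkseq // subnKC //.
  apply: choose_bit => //.
  have sle : stop <= Qb - size z by rewrite -[X in _ <= X](size_iota 0); apply: find_size.
  have := before_find 0 js; rewrite nth_iota; last by lia.
  by rewrite add0n subnKC // jW /= => ->.
rewrite nth_default; last by rewrite size_map size_cat size_mkseq; lia.
have [Qj|jQ] := leqP Qb j.
  apply: fact_init => //.
  by rewrite /evalg /= /posf /setpos /updf /= f0Q Qj.
have {}sj : size z + stop <= j by lia.
(* There remain the cells from the end of the certificate up to [Qb]: [AEnd] makes the first one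
   blank, and a clause spreads the blank to the right. *)
rewrite -(subnKC sj) in jW jQ *; move: (j - _) jW jQ => k {j zj sj}.
elim: k => [|k IH] jW jQ.
  rewrite addn0 in jW jQ *.
  have hs : has (fun i => (size z + i < W) && ended (size z + i)) (iota 0 (Qb - size z)).
    by rewrite has_find size_iota -/stop; lia.
  have := nth_find 0 hs; rewrite -/stop nth_iota; last by lia.
  rewrite add0n => /andP[_ /eqP en].
  apply: (@sat_horn 0 0 0 (size z + stop) 0 (size z + stop) AS AEnd) => //; last by rewrite forceS1.
  by rewrite /evalg /= /posf /setpos /updf /= !leqnn.
rewrite addnS in jW jQ *.
have {}IH := IH (ltnW jW) (ltnW jQ); have jW' := ltnW jW.
apply: (@sat_horn 0 (size z + stop + k) 0 (size z + stop + k) 0 (size z + stop + k).+1 (AR None) (AR None)) => //.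
- by rewrite /evalg /= /posf /setpos /updf /= !leqnn.
- exact: fact1.
- exact: fact2.
Qed.

Lemma acceptable_of_sat : acceptable.
Proof.
exists guessed; last exact: acc_of_sat guessed_row.
rewrite size_mkseq -[X in _ <= X](size_iota 0); exact: find_size.
Qed.

End Soundness.

(** * Completeness: an accepted certificate yields an assignment *)

Section Completeness.

Variable u : seq bool.
Hypothesis uQ : size u <= Qb - size z.
Hypothesis Hacc : accq (row_q (trace (z ++ u) W.-1)).

(** The intended interpretation. [AZero] also holds past the end of the word, since [AZero] or
    [AOne] has to hold at every cell; [AMore] keeps this from producing a letter there. *)
Definition truth x y a : bool :=
  let c := trace (z ++ u) x in
  match a with
  | AH q s => (q == row_q c) && (s == row_s c)
  | AL s => s == row_l c y
  | AR s => s == row_r c y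
  | AMore => letter (z ++ u) y != None
  | AEnd => letter (z ++ u) y == None
  | AZero | AZero' => letter (z ++ u) y != Some true
  | AOne | AOne' => letter (z ++ u) y == Some true
  | AS => true
  | AF | AP _ => false
  end.

Lemma letter_none v y : letter v y = None -> letter v y.+1 = None.
Proof.
rewrite /letter => h; apply: nth_default.
rewrite size_map; have [h2|] := leqP (size v) y; first by lia.
by move=> yv; move: h; rewrite (nth_map false).
Qed.

Lemma traceS v n : trace v n.+1 = rstep (trace v n).
Proof. by []. Qed.

Local Ltac evs ev := move: ev; rewrite /evalg /= /posf /setpos /updf /=; lia.

(** In each case the guard relates the coordinates, and the clause follows from [rstep] or from
    [letter]; the clause concluding [AF] is vacuous because the last state accepts. *)
Lemma horn_truth x1 y1 x2 y2 x3 y3 a1 a2 a3 g : x1 < W ->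
  hornrule a1 a2 a3 = Some g ->
  evalg z g (Store (posf f0 x1 y1 x2 y2 x3 y3) [::]) ->
  truth x1 y1 a1 -> truth x2 y2 a2 -> truth x3 y3 a3.
Proof.
move=> x1W; rewrite /truth.
case: a1 => [q s|s|s|||||||||b1]; case: a2 => [q0 s0|s0|s0|||||||||b2];
  case: a3 => [q' s'|s'|s'|||||||||b3] //.
all: try by case: s.
all: try by case: s => [?|]; case: s0.
- rewrite /=; case E: (nxt q s) => [[q1 w1] []] //; case: ifP => //.
  case/and4P=> /eqP-> /eqP-> /eqP-> /eqP-> [<-] ev /andP[/eqP hq /eqP hs] _.
  have [e2 e3] : x2 = x1 /\ x3 = x1.+1 by evs ev.
  by rewrite e3 traceS /rstep -hq -hs E /= !eqxx.
- rewrite /=; case E: (nxt q s) => [[q1 w1] []] //; case: ifP => //.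
  case/and3P=> /eqP-> /eqP-> /eqP-> [<-] ev /andP[/eqP hq /eqP hs] _.
  have [e3 e4] : x3 = x1.+1 /\ y3 = 0 by evs ev.
  by rewrite e3 e4 traceS /rstep -hq -hs E /= !eqxx.
- rewrite /=; case E: (nxt q s) => [[q1 w1] []] //; case: ifP => //.
  case/and3P=> /eqP-> /eqP-> /eqP-> [<-] ev /andP[/eqP hq /eqP hs] _.
  have [e3 e4] : x3 = x1.+1 /\ y3 = 0 by evs ev.
  by rewrite e3 e4 traceS /rstep -hq -hs E /= !eqxx.
- rewrite /=; case: ifP => // /and3P[/eqP-> /eqP-> nacc] [<-] ev /andP[/eqP hq _] _.
  have e1 : x1 = W.-1 by move: ev; rewrite /evalg /= /posf /setpos /updf /= f0W; lia.
  by move: nacc; rewrite hq e1 Hacc.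
- rewrite /=; case E: (nxt q s) => [[q1 w1] []] //; case: ifP => // /andP[/eqP-> /eqP->].
  move=> [<-] ev /andP[/eqP hq /eqP hs] /eqP->.
  have [e2 [e3 e4]] : x2 = x1 /\ x3 = x1.+1 /\ y2 = 0 by evs ev.
  by rewrite e2 e3 e4 traceS /rstep -hq -hs E /= !eqxx.
- rewrite /=; case: eqP => // -> [<-]; case E: (nxt q s) => [[q1 w1] mv] /=.
  move=> ev /andP[/eqP hq /eqP hs] /eqP->.
  case: mv E ev => E ev /=.
  + have [e2 [e3 e4]] : x2 = x1 /\ x3 = x1.+1 /\ y2 = y3.+1 by evs ev.
    by rewrite e2 e3 traceS /rstep -hq -hs E e4.
  + have [e2 [e3 e4]] : x2 = x1 /\ x3 = x1.+1 /\ y3 = y2.+1 by evs ev.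
    by rewrite e2 e3 traceS /rstep -hq -hs E e4.
  + have [e2 [e3 e4]] : x2 = x1 /\ x3 = x1.+1 /\ y2 = y3 by evs ev.
    by rewrite e2 e3 traceS /rstep -hq -hs E e4.
- rewrite /=; case E: (nxt q s) => [[q1 w1] []] //; case: ifP => // /andP[/eqP-> /eqP->].
  move=> [<-] ev /andP[/eqP hq /eqP hs] /eqP->.
  have [e2 [e3 e4]] : x2 = x1 /\ x3 = x1.+1 /\ y2 = 0 by evs ev.
  by rewrite e2 e3 e4 traceS /rstep -hq -hs E /= !eqxx.
- rewrite /=; case: eqP => // -> [<-]; case E: (nxt q s) => [[q1 w1] mv] /=.
  move=> ev /andP[/eqP hq /eqP hs] /eqP->.
  case: mv E ev => E ev /=.
  + have [e2 [e3 e4]] : x2 = x1 /\ x3 = x1.+1 /\ y3 = y2.+1 by evs ev.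
    by rewrite e2 e3 traceS /rstep -hq -hs E e4.
  + have [e2 [e3 e4]] : x2 = x1 /\ x3 = x1.+1 /\ y2 = y3.+1 by evs ev.
    by rewrite e2 e3 traceS /rstep -hq -hs E e4.
  + have [e2 [e3 e4]] : x2 = x1 /\ x3 = x1.+1 /\ y2 = y3 by evs ev.
    by rewrite e2 e3 traceS /rstep -hq -hs E e4.
- case: s => [?|]; case: s0 => [?|]; case: s' => [?|] //= [<-] ev + _.
  have [e1 [e3 e4]] : x1 = 0 /\ x3 = 0 /\ y3 = y1.+1 by evs ev.
  by rewrite e1 e3 e4 /= => /eqP/esym/letter_none ->.
- case: s' => [[]|] //= [<-] ev.
  have [e1 [e2 e3]] : x3 = 0 /\ y1 = y3 /\ y2 = y3 by evs ev.
  by rewrite e1 e2 e3 /=; case: letter => [[]|].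
- case: s' => [[]|] //= [<-] ev.
  have [e1 [e2 e3]] : x3 = 0 /\ y1 = y3 /\ y2 = y3 by evs ev.
  by rewrite e1 e2 e3 /=; case: letter => [[]|].
- by move=> /= [<-] ev; have -> : y1 = y3 by evs ev.
- case: s' => [?|] //= [<-] ev _.
  have [e1 e2] : x3 = 0 /\ y2 = y3 by evs ev.
  by rewrite e1 e2 /= => /eqP ->.
- by move=> /= [<-] ev _; have -> : y2 = y3 by evs ev.
- case: q' => [?|]; case: s' => [?|] //= [<-] ev _ _.
  by have -> : x3 = 0 by evs ev.
- case: s' => [?|] //= [<-] ev _ _.
  by have -> : x3 = 0 by evs ev.
- case: s' => [b|] //= [<-] ev _ _.
    have /and3P[/eqP-> y3z /eqP yb] : [&& x3 == 0, y3 < size z & nth false z y3 == b].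
      by move: ev; rewrite /evalg /= /posf /setpos /updf /= andbT.
    by rewrite /= /letter (nth_map false) ?size_cat ?nth_cat ?y3z ?yb //; lia.
  have /andP[/eqP-> Qy3] : (x3 == 0) && (Qb <= y3).
    by move: ev; rewrite /evalg /= /posf /setpos /updf /= f0Q andbT.
  by rewrite /= /letter nth_default // size_map size_cat; lia.
Qed.

(** In the block, player 1 covers the outcomes 3 and 4, player 2 covers 5 and 7, player 3 covers 6,
    and the sixth element stays at 2. Elsewhere values encode [truth], with reversed polarity for
    player 3. *)
Definition value1 (x y : nat) a : outcome :=
  match a with
  | AS => inord 2
  | AP b => inord (if b then 4 else 3)
  | _ => inord (truth x y a)
  end.

Definition value2 (x y : nat) a : outcome :=
  match a with
  | AS => inord 2
  | AP b => inord (if b then 5 else 7)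
  | _ => inord (truth x y a)
  end.

Definition value3 (x y : nat) a : outcome :=
  match a with
  | AF => inord 2
  | AP b => inord (if b then 6 else 2)
  | _ => inord (~~ truth x y a)
  end.

Definition isAP (a : atom) : bool := if a is AP _ then true else false.

Lemma horn_noAP a1 a2 a3 g : hornrule a1 a2 a3 = Some g -> ~~ [|| isAP a1, isAP a2 | isAP a3].
Proof.
case: a1 => [q s|s|s|||||||||b1]; case: a2 => [q0 s0|s0|s0|||||||||b2] //;
  case: a3 => [q' s'|s'|s'|||||||||b3] //.
all: try by case: s.
all: by case: s => [?|]; case: s0.
Qed.

Lemma link_sat x1 y1 x2 y2 x3 y3 a1 a2 a3 g :
  linkrule a1 a2 a3 = Some g ->
  evalg z g (Store (posf f0 x1 y1 x2 y2 x3 y3) [::]) ->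
  [\/ value1 x1 y1 a1 = inord 1, value2 x2 y2 a2 = inord 1 | value3 x3 y3 a3 = inord 1].
Proof.
have bool_dec b : inord (b : bool) = inord 1 :> outcome \/ inord (~~ b) = inord 1 :> outcome.
  by case: b; [left | right].
case: a1 => [q s|s|s|||||||||b1]; case: a2 => [q0 s0|s0|s0|||||||||b2] //.
all: try by case: a3.
all: try (rewrite /linkrule /derived; case: ifP => // /andP[_ /eqP/(can_inj atom_encK) <-] [<-] ev;
  have [ex ey] : x1 = x3 /\ y1 = y3 by evs ev).
all: try (rewrite /linkrule /derived; case: ifP => // /andP[_ /eqP/(can_inj atom_encK) <-] [<-] ev;
  have [ex ey] : x2 = x3 /\ y2 = y3 by evs ev).
all: try by rewrite ex ey /value1 /value3; set b := truth _ _ _; case: (bool_dec b);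
  [constructor 1 | constructor 3].
all: try by rewrite ex ey /value2 /value3; set b := truth _ _ _; case: (bool_dec b);
  [constructor 2 | constructor 3].
all: case: a3 => // [[<-]] ev; have -> : y1 = y2 by evs ev.
all: rewrite /value1 /value2 /truth.
all: by case: (_ == _); [constructor 2 | constructor 1].
Qed.

Lemma block_sat x1 y1 x2 y2 x3 y3 a1 a2 a3 n : blockrule a1 a2 a3 = Some n ->
  [\/ value1 x1 y1 a1 = inord n, value2 x2 y2 a2 = inord n | value3 x3 y3 a3 = inord n].
Proof.
case: a1 => [q s|s|s|||||||||b1]; case: a2 => [q0 s0|s0|s0|||||||||b2] //;
  case: a3 => [q' s'|s'|s'|||||||||b3] //.
all: try case: b1; try case: b2; try case: b3; rewrite // => -[<-].
all: by [constructor 1 | constructor 2 | constructor 3].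
Qed.

(** The values satisfy every applicable rule and not just the first one, so each kind of rule is
    treated on its own. *)
Lemma sat_of_acceptable : sat value1 value2 value3.
Proof.
move=> x1 y1 x2 y2 x3 y3 a1 a2 a3 o x1W _ _ _ _ _; rewrite /firstrule /rules.
rewrite !filter_cat !map_cat.
have val_false y x a : ~~ truth x y a -> ~~ isAP a ->
    value1 x y a = inord 0 /\ value2 x y a = inord 0.
  move=> /negbTE ht na; rewrite /value1 /value2.
  by case: a ht na => [q s|s|s|||||||||b] ht na //; rewrite ht.
have val_true y x a : truth x y a -> ~~ isAP a -> value3 x y a = inord 0.
  by move=> ht na; rewrite /value3; case: a ht na => [q s|s|s|||||||||b] ht na //; rewrite ht.
set horn := [seq _ | _ <- _]; set rest := (X in horn ++ X).
have rest_sat : ohead rest = Some o ->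
    [\/ value1 x1 y1 a1 = o, value2 x2 y2 a2 = o | value3 x3 y3 a3 = o].
  have blk : ohead [seq r.2 | r <- (if blockrule a1 a2 a3 is Some n then [:: ([::], inord n : outcome)] else [::])
       & evalg z r.1 (Store (posf f0 x1 y1 x2 y2 x3 y3) [::])] = Some o ->
    [\/ value1 x1 y1 a1 = o, value2 x2 y2 a2 = o | value3 x3 y3 a3 = o].
    by case Eb: (blockrule a1 a2 a3) => [n|] //= [<-]; apply: block_sat Eb.
  rewrite /rest; case El: (linkrule a1 a2 a3) => [g|] //=.
  by case: ifP => [ev [<-]|_] //; exact: link_sat El ev.
rewrite /horn; case Eh: (hornrule a1 a2 a3) => [g|] //=.
case: ifP => [ev [<-]|_] //.
have /norP[n1 /norP[n2 n3]] := horn_noAP Eh.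
have H := horn_truth x1W Eh ev.
have [h1|/val_false/(_ n1)[]] := boolP (truth x1 y1 a1); last by constructor 1.
have [h2|/val_false/(_ n2)[]] := boolP (truth x2 y2 a2); last by constructor 2.
by constructor 3; apply: val_true => //; apply: H.
Qed.

End Completeness.

End Game.

(** * The tableau of a Turing machine *)


Definition row_of (M : TM) (c : config M) : row M :=
  Row (Some (cf_state c)) (cf_cur c) (nth None (cf_left c)) (nth None (cf_right c)).

Lemma row_ext (M : TM) (c c' : row M) : row_q c = row_q c' -> row_s c = row_s c' ->
  (forall j, row_l c j = row_l c' j) -> (forall j, row_r c j = row_r c' j) -> c = c'.
Proof.
case: c c' => [q s l r] [q' s' l' r'] /= -> -> hl hr.
by congr Row; apply: functional_extensionality.
Qed.

Lemma row_of_step (M : TM) (c : config M) : rstep (row_of c) = row_of (tm_step c).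
Proof.
case: c => q l s r; rewrite /rstep /row_of /tm_step /nxt /=.
case: (tm_halt q) => //=; case: (tm_delta q s) => [[q' w] mv] /=.
case: mv; first case: l => [|x l]; last by [].
- by apply: row_ext => //= -[].
- by apply: row_ext => //= -[].
case: r => [|x r]; apply: row_ext => //= -[] //.
Qed.

(** The shift by one is the extra first step that moves the head onto the input. *)
Lemma trace_run (M : TM) v n : trace M v n.+1 = row_of (tm_run n (tm_init M v)).
Proof.
elim: n => [|n IH]; last by rewrite traceS IH row_of_step.
by rewrite traceS; case: v => [|b v]; apply: row_ext => //= -[].
Qed.

Lemma halted_run (M : TM) (c : config M) t n : halted (tm_run t c) -> t <= n ->
  tm_run n c = tm_run t c.
Proof.
move=> h /subnK <-; rewrite {1}/tm_run iterD -/(tm_run t c).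
by elim: (n - t) => [|k IH] //=; rewrite IH /tm_step -/(halted _) h.
Qed.

(** * Computing the parameters *)


Section Arithmetic.

Variables (K : nat) (z : seq bool).

Fixpoint incn i n : prog unit := if n is n'.+1 then @incp K i ;; incn i n' else ret tt.

Lemma spec_incn σ i n : i < K -> spec K z (incn i n) σ n.+1 tt (upd σ i (cnt σ i + n)).
Proof.
move=> iK; elim: n σ => [|n IH] σ /=.
  by rewrite addn0 upd_id //; apply: spec_ret.
apply: (@spec_le _ _ _ _ _ (1 + n.+1)); first lia.
apply: spec_seqp; first exact: spec_inc.
by have := IH (upd σ i (cnt σ i).+1); rewrite upd_upd /= updfE addSnnS.
Qed.

Variable a : nat.
Hypothesis aK : a < K.

(** Copying [j] to the scratch counter [a] beforehand makes [i = j] legitimate, which [powp] uses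
    for doubling. *)
Definition addp i j : prog unit := set_counter K a j ;; forr K a (@incp K i).

Lemma spec_addp σ i j : i < K -> j < K -> i != a -> cnt σ a = 0 ->
  spec K z (addp i j) σ (1 + (cnt σ j).+1 * 4) tt (upd σ i (cnt σ i + cnt σ j)).
Proof.
move=> iK jK ia a0; set V := cnt σ j.
pose h v := upd σ i (cnt σ i + (V - v)).
apply: spec_seqp; first exact: spec_set_counter.
have -> : upd σ a (cnt σ j) = upd (h V) a V.
  by rewrite /h subnn addn0 (@upd_id σ i).
have -> : upd σ i (cnt σ i + V) = upd (h 0) a 0.
  by rewrite (@upd_id (h 0) a) /h ?subn0 //= /updf eq_sym (negbTE ia).
apply: (@spec_forr K z a _ h V 1) => // v vV.
have := @spec_inc K z (upd (h v.+1) a v) i iK.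
have -> : cnt (upd (h v.+1) a v) i = cnt σ i + (V - v.+1).
  by rewrite /= /updf (negbTE ia) eqxx.
rewrite /upd /h /= (@updfC _ a i) 1?eq_sym // updf_updf.
by have -> : (cnt σ i + (V - v.+1)).+1 = cnt σ i + (V - v) by lia.
Qed.

Variable b : nat.
Hypotheses (bK : b < K) (ab : a != b).

Definition mulp i j : prog unit := set_counter K b i ;; clear K i ;; forr K b (addp i j).

Lemma spec_mulp σ i j : i < K -> j < K -> i != a -> i != b -> j != b -> i != j ->
  cnt σ a = 0 -> cnt σ b = 0 ->
  spec K z (mulp i j) σ (2 + (cnt σ i).+1 * ((cnt σ j).+1 * 4 + 4)) tt
       (upd σ i (cnt σ i * cnt σ j)).
Proof.
move=> iK jK ia ib jb ij a0 b0; set V := cnt σ i.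
pose h v := upd σ i ((V - v) * cnt σ j).
apply: (@spec_le _ _ _ _ _ (1 + (1 + V.+1 * ((1 + (cnt σ j).+1 * 4) + 3)))); first lia.
apply: spec_seqp; first exact: spec_set_counter.
apply: spec_seqp; first exact: spec_clear.
have -> : upd (upd σ b (cnt σ i)) i 0 = upd (h V) b V.
  by rewrite /h subnn mul0n /upd /= updfC // eq_sym.
have -> : upd σ i (V * cnt σ j) = upd (h 0) b 0.
  by rewrite (@upd_id (h 0) b) /h ?subn0 //= /updf eq_sym (negbTE ib).
apply: (@spec_forr K z b _ h V) => // v vV.
have := @spec_addp (upd (h v.+1) b v) i j iK jK ia.
have -> : cnt (upd (h v.+1) b v) j = cnt σ j.
  by rewrite /= /updf (negbTE jb) eq_sym (negbTE ij).
have -> : cnt (upd (h v.+1) b v) i = (V - v.+1) * cnt σ j.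
  by rewrite /= /updf (negbTE ib) eqxx.
rewrite /upd /h /= {1 2}/updf (negbTE ab) eq_sym (negbTE ia) => /(_ a0).
rewrite (@updfC _ b i) 1?eq_sym // updf_updf -mulSnr.
by have -> : (V - v.+1).+1 = V - v by lia.
Qed.

Fixpoint mulk i j k : prog unit := if k is k'.+1 then mulp i j ;; mulk i j k' else ret tt.

Lemma spec_mulk σ i j k : i < K -> j < K -> i != a -> i != b -> j != b -> i != j ->
  cnt σ a = 0 -> cnt σ b = 0 -> 0 < cnt σ j ->
  spec K z (mulk i j k) σ
       (k * (2 + (cnt σ i * cnt σ j ^ k).+1 * ((cnt σ j).+1 * 4 + 4)) + 1) tt
       (upd σ i (cnt σ i * cnt σ j ^ k)).
Proof.
move=> iK jK ia ib jb ij; elim: k σ => [|k IH] σ a0 b0 j0 /=.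
  by rewrite muln1 upd_id // mul0n; apply: spec_ret.
set σ' := upd σ i (cnt σ i * cnt σ j).
have ej : cnt σ' j = cnt σ j by rewrite /= /updf eq_sym (negbTE ij).
have ei : cnt σ' i = cnt σ i * cnt σ j by rewrite /= updfE.
have := IH σ'; rewrite ej ei -mulnA -expnS.
have -> : cnt σ' a = cnt σ a by rewrite /= /updf eq_sym (negbTE ia).
have -> : cnt σ' b = cnt σ b by rewrite /= /updf eq_sym (negbTE ib).
rewrite upd_upd => /(_ a0 b0 j0) {}IH.
apply: spec_le; last first.
  by apply: spec_seqp; [apply: spec_mulp | exact: IH].
(* Counter [j] is positive, so partial products stay below the final one and a single cost serves
   every round. *)
have H : cnt σ i <= cnt σ i * cnt σ j ^ k.+1 by rewrite leq_pmulr // expn_gt0 j0.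
have := leq_mul H (leqnn ((cnt σ j).+1 * 4 + 4)); rewrite [k.+1 * _]mulSn; lia.
Qed.

End Arithmetic.

(** * Certificate bound, time bound and width *)

Section Setup.

Variables (z : seq bool) (n c k c' k' : nat).

(** Counter 0 starts at [2 * n + 2]; half of it, [n + 1], is the base of [poly_bound c k n]. *)
Definition halfp : prog unit :=
  loop (bind (checkg nctr (eqg cH cL)) (fun v =>
    if v then ret (Some tt) else
      @incp nctr cH ;; @incp nctr cH ;; @incp nctr cN ;; ret None)).

Lemma spec_halfp σ : cnt σ cL = 2 * n + 2 -> cnt σ cH = 0 -> cnt σ cN = 0 ->
  spec nctr z halfp σ (n.+2 * 5) tt (upd (upd σ cH (2 * n + 2)) cN n.+1).
Proof.
move=> L0 H0 N0; pose h i := upd (upd σ cH (2 * i)) cN i.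
have -> : σ = h 0.
  by rewrite /h muln0 (@upd_id σ) // upd_id.
have -> : upd (upd (h 0) cH (2 * n + 2)) cN n.+1 = h n.+1.
  apply: store_ext => // i; rewrite /h /= /updf.
  by do 2! [case: eqP => // _]; lia.
have ev i : evalg z (eqg cH cL) (h i) = (i == n.+1).
  by rewrite /evalg /= /updf /= L0; lia.
apply: spec_loop_iter => [i iV|].
  apply: (@spec_le _ _ _ _ _ (1 + (1 + (1 + (1 + 1))))) => //.
  apply: spec_bind; first exact: spec_checkg.
  rewrite ev (ltn_eqF iV).
  apply: spec_seqp; first exact: spec_inc.
  apply: spec_seqp; first exact: spec_inc.
  apply: spec_seqp; first exact: spec_inc.
  set σ' := upd _ _ _.
  have -> : σ' = h i.+1; last exact: spec_ret.
  apply: store_ext => // x; rewrite /σ' /h /= /updf /=.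
  by do 2! [case: eqP => // _]; lia.
apply: (@spec_le _ _ _ _ _ (1 + 1)) => //.
apply: spec_bind; first exact: spec_checkg.
by rewrite ev eqxx; apply: spec_ret.
Qed.

(** The exponent is recorded along with the power, since printing the dimensions in binary needs
    it. *)
Definition powp : prog unit :=
  loop (bind (checkg nctr [:: TLe cB cX]) (fun v =>
    if v then ret (Some tt) else addp nctr tA cX cX ;; @incp nctr cK ;; ret None)).

Lemma spec_powp σ : cnt σ cX = 1 -> cnt σ cK = 0 -> cnt σ tA = 0 ->
  let e := up_log 2 (cnt σ cB) in
  spec nctr z powp σ (e.+1 * (8 + 4 * 2 ^ e)) tt (upd (upd σ cX (2 ^ e)) cK e).
Proof.
move=> X1 K0 A0; set V := cnt σ cB => e; pose h i := upd (upd σ cX (2 ^ i)) cK i.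
have -> : σ = h 0 by rewrite /h (@upd_id σ) // upd_id.
have -> : upd (upd (h 0) cX (2 ^ e)) cK e = h e.
  by apply: store_ext => // i; rewrite /h /= /updf; do 2! [case: eqP => // _].
have ev i : evalg z [:: TLe cB cX] (h i) = (V <= 2 ^ i).
  by rewrite /evalg /= /updf /= andbT.
apply: spec_loop_iter => [i iV|].
  apply: (@spec_le _ _ _ _ _ (1 + ((1 + (2 ^ i).+1 * 4) + (1 + 1)))).
    by have := leq_pexp2l (isT : 0 < 2) (ltnW iV); lia.
  apply: spec_bind; first exact: spec_checkg.
  have -> : evalg z [:: TLe cB cX] (h i) = false.
    rewrite ev leqNgt; apply/negbTE/negPn; rewrite ltnNge; apply/negP => H.
    by have := up_log_min (isT : 1 < 2) H; rewrite leqNgt iV.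
  apply: spec_seqp; first by apply: (@spec_addp nctr z tA isT (h i) cX cX).
  apply: spec_seqp; first exact: spec_inc.
  set σ' := upd _ _ _.
  have -> : σ' = h i.+1; last exact: spec_ret.
  apply: store_ext => // x; rewrite /σ' /h /= /updf /=.
  by do 2! [case: eqP => // _]; rewrite expnS; lia.
apply: (@spec_le _ _ _ _ _ (1 + 1)) => //.
apply: spec_bind; first exact: spec_checkg.
by rewrite ev up_logP //; apply: spec_ret.
Qed.

(** The largest length of [enc_pair w u] over the admissible certificates [u]. *)
Definition guess_bound := 2 * n + 2 + poly_bound c k n.
(** Time [W - 1] of the tableau is reached after [W - 2] steps of the verifier, hence the summand
    2. *)
Definition time_bound := poly_bound c' k' guess_bound + guess_bound + 2.
Definition log_width := up_log 2 time_bound.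

(** [cN] serves twice as the base of a power: first as [n + 1], then as [guess_bound + 1]. *)
Definition setup : prog unit :=
  halfp ;; incn nctr cB c ;; mulk nctr tA tB cB cN k ;;
  set_counter nctr cQ cL ;; addp nctr tA cQ cB ;;
  set_counter nctr cN cQ ;; @incp nctr cN ;; clear nctr cB ;; incn nctr cB c' ;;
  mulk nctr tA tB cB cN k' ;; addp nctr tA cB cQ ;; incn nctr cB 2 ;;
  @incp nctr cX ;; powp.

Definition setup_cost :=
  n.+2 * 5 + (c.+1 + ((k * (2 + (poly_bound c k n).+1 * (n.+2 * 4 + 4)) + 1) +
  (1 + ((1 + (poly_bound c k n).+1 * 4) + (1 + (1 + (1 + (c'.+1 +
  ((k' * (2 + (poly_bound c' k' guess_bound).+1 * (guess_bound.+2 * 4 + 4)) + 1) +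
  ((1 + guess_bound.+1 * 4) + (3 + (1 + log_width.+1 * (8 + 4 * 2 ^ log_width))))))))))))).

Definition mk (l m q x e b h i : nat) : nat :=
  match i with
  | cL => l | cN => m | cQ => q | cX => x | cK => e | cB => b | cH => h | _ => 0
  end.

Definition mkst l m q x e b h := Store (mk l m q x e b h) [::].

Lemma mkst_upd l m q x e b h v :
  (upd (mkst l m q x e b h) cN v = mkst l v q x e b h) *
  (upd (mkst l m q x e b h) cQ v = mkst l m v x e b h) *
  (upd (mkst l m q x e b h) cX v = mkst l m q v e b h) *
  (upd (mkst l m q x e b h) cK v = mkst l m q x v b h) *
  (upd (mkst l m q x e b h) cB v = mkst l m q x e v h) *
  (upd (mkst l m q x e b h) cH v = mkst l m q x e b v).
Proof. by do !split; apply: store_ext => // i; do 21! [case: i => [|i] //]. Qed.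

Definition setup_cnt : nat -> nat :=
  mk (2 * n + 2) guess_bound.+1 guess_bound (2 ^ log_width) log_width time_bound (2 * n + 2).

Lemma spec_setup f : (forall i, f i = if i == 0 then 2 * n + 2 else 0) ->
  spec nctr z setup (Store f [::]) setup_cost tt (Store setup_cnt [::]).
Proof.
move=> fE; pose Q := guess_bound; pose P := poly_bound c k n.
pose P' := poly_bound c' k' guess_bound; pose e := log_width.
have -> : Store f [::] = mkst (2 * n + 2) 0 0 0 0 0 0.
  by apply: store_ext => // i; rewrite /= fE; do 21! [case: i => [|i] //].
apply: spec_seqp; first exact: spec_halfp.
rewrite !mkst_upd.
apply: spec_seqp; first exact: spec_incn.
rewrite mkst_upd.
apply: spec_seqp.
  by apply: (@spec_mulk nctr z tA isT tB isT isT _ cB cN k).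
rewrite mkst_upd -/P.
apply: spec_seqp; first exact: spec_set_counter.
rewrite mkst_upd.
apply: spec_seqp; first by apply: (@spec_addp nctr z tA isT _ cQ cB).
rewrite mkst_upd -/Q.
apply: spec_seqp; first exact: spec_set_counter.
rewrite mkst_upd.
apply: spec_seqp; first exact: spec_inc.
rewrite mkst_upd.
apply: spec_seqp; first exact: spec_clear.
rewrite mkst_upd.
apply: spec_seqp; first exact: spec_incn.
rewrite mkst_upd.
apply: spec_seqp.
  by apply: (@spec_mulk nctr z tA isT tB isT isT _ cB cN k').
rewrite mkst_upd -/P'.
apply: spec_seqp; first by apply: (@spec_addp nctr z tA isT _ cB cQ).
rewrite mkst_upd.
apply: spec_seqp; first exact: spec_incn.
rewrite mkst_upd.
apply: spec_seqp; first exact: spec_inc.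
rewrite mkst_upd.
have := @spec_powp (mkst (2 * n + 2) Q.+1 Q 1 0 time_bound (2 * n + 2)) erefl erefl erefl.
by cbv zeta; rewrite !mkst_upd; exact.
Qed.

End Setup.

(** * Emitting the table *)


Lemma size_enc_nat_small m : m <= 8 -> size (enc_nat m) <= 10.
Proof. by do 9! [case: m => [|m] //]. Qed.

Definition enc_outcome (o : option outcome) : seq bool := @enc_entry 8 o.

Section Table.

Variables (K : nat) (z : seq bool).

Fixpoint entp (l : seq rule) : prog unit :=
  if l is (g, a) :: l' then
    bind (checkg K g) (fun v => if v then emit_str (enc_outcome (Some a)) else entp l')
  else emit_str (enc_outcome None).

Lemma evalg_store g f o : evalg z g (Store f o) = evalg z g (Store f [::]).
Proof. by apply: eq_all => -[]. Qed.

Lemma guardok_store g f o : guardok K g (Store f o) = guardok K g (Store f [::]).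
Proof. by apply: eq_all => -[]. Qed.

Lemma emits_entp l f : all (fun r => guardok K r.1 (Store f [::])) l ->
  emits K z (entp l) f (enc_outcome (firstrule z l f)) (size l + 11).
Proof.
elim: l => [|[g a] l IH].
  by move=> _ o; apply: (@spec_le _ _ _ _ _ 3) => //; apply: emits_str.
case/andP=> okg /IH {}IH o.
apply: (@spec_le _ _ _ _ _ (1 + (size l + 11))) => //.
apply: spec_bind; first by apply: spec_checkg; rewrite guardok_store.
rewrite evalg_store /firstrule [filter _ _]/=; case: (evalg z g _); last exact: IH.
apply: (@spec_le _ _ _ _ _ (size (enc_outcome (Some a))).+1); last exact: emits_str.
by have := size_enc_nat_small (ltn_ord a); rewrite -/(enc_outcome (Some a)) /enc_outcome /enc_entry; lia.
Qed.

Fixpoint seqdown n (P : nat -> prog unit) : prog unit :=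
  if n is n'.+1 then P n' ;; seqdown n' P else ret tt.

Lemma emits_seqdown n P f F c : (forall i, i < n -> emits K z (P i) f (F i) c) ->
  emits K z (seqdown n P) f (flatten [seq F i | i <- iota 0 n]) (n * c + 1).
Proof.
elim: n => [|n IH] H o; first exact: spec_ret.
rewrite -[in iota 0 _]addn1 iotaD map_cat flatten_cat /= cats0 add0n -catA mulSn -addnA.
apply: spec_seqp; first exact: H.
by apply: IH => i ni; apply: H; lia.
Qed.

(** The number of an atom is no counter: its range depends only on the machine, so [seqdown] unrolls
    it in the program. *)
Definition posp t s j u C (P : nat -> prog unit) : prog unit :=
  fordown K t s cX (fordown K j u cX (seqdown C P)).

Definition posstr C X (F : nat -> nat -> nat -> seq bool) : seq bool :=
  flatten [seq flatten [seq flatten [seq F x y c | c <- iota 0 C] | y <- iota 0 X] | x <- iota 0 X].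

Definition poscost C X c := X.+1 * (X.+1 * (C * c + 1 + 7) + 7).

Lemma emits_posp t s j u C P f F c :
  uniq [:: t; s; j; u; cX] -> all (fun i => i < K) [:: t; s; j; u; cX] ->
  [/\ f t = 0, f s = 0, f j = 0 & f u = 0] ->
  (forall x y i, x < f cX -> y < f cX -> i < C ->
     emits K z (P i) (setpos f t s j u x y) (F x y i) c) ->
  emits K z (posp t s j u C P) f (posstr C (f cX) F) (poscost C (f cX) c).
Proof.
rewrite /= !inE !negb_or; case/and5P=> /and4P[ts tj tu tX] /and3P[sj su sX] /andP[ju jX] uX _.
case/and5P=> tK sK jK uK /andP[XK _] [t0 s0 j0 u0] H.
apply: emits_fordown => // x xX.
set f1 := updf _ _ _.
have f1X : f1 cX = f cX.
  by rewrite /f1 /updf [cX == s]eq_sym (negbTE sX) [cX == t]eq_sym (negbTE tX).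
rewrite -f1X.
apply: (emits_fordown (F := fun y => flatten [seq F x y i | i <- iota 0 C]) (c := C * c + 1)) => //.
- by rewrite /f1 /updf [j == s]eq_sym (negbTE sj) [j == t]eq_sym (negbTE tj).
- by rewrite /f1 /updf [u == s]eq_sym (negbTE su) [u == t]eq_sym (negbTE tu).
move=> y yX; apply: emits_seqdown => i iC.
by apply: H => //; rewrite -f1X.
Qed.

End Table.

Section Output.

Variables (C : nat) (rl : nat -> nat -> nat -> seq rule) (z : seq bool).

Definition tablep : prog unit :=
  posp nctr t1 s1 j1 u1 C (fun c1 => posp nctr t2 s2 j2 u2 C (fun c2 =>
    posp nctr t3 s3 j3 u3 C (fun c3 => entp nctr (rl c1 c2 c3)))).

Definition tablestr f : seq bool :=
  let X := f cX in
  posstr C X (fun x1 y1 c1 => posstr C X (fun x2 y2 c2 => posstr C X (fun x3 y3 c3 =>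
    enc_outcome (firstrule z (rl c1 c2 c3) (posf f x1 y1 x2 y2 x3 y3))))).

Variable e : nat.

(** Read backwards, the code of a power of two is the terminator, the doubled top bit and a run of
    zeros, two per binary digit; this is why sizes are powers of two. The exponent is twice [cK]
    plus the constant [e]. *)
Definition dimp : prog unit :=
  emit_str [:: true; true; false; true] ;; emit_str (nseq (2 * e) false) ;;
  fordown nctr t1 s1 cK (emit_str [:: false; false]) ;;
  fordown nctr t1 s1 cK (emit_str [:: false; false]).

Lemma bits_aux_pow2 m fuel : m < fuel -> bits_aux fuel (2 ^ m) = rcons (nseq m false) true.
Proof.
elim: m fuel => [|m IH] [|fuel] //= mf; first by case: fuel {mf}.
have -> : 2 ^ m.+1 = (2 ^ m).*2 by rewrite expnS mul2n.
have : 0 < 2 ^ m by rewrite expn_gt0.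
rewrite -(IH fuel) // odd_double doubleK.
by case: (2 ^ m).
Qed.

Lemma enc_nat_pow2 m : enc_nat (2 ^ m) = nseq (2 * m) false ++ [:: true; true; false; true].
Proof.
rewrite /enc_nat bits_aux_pow2; last exact: ltn_expl.
rewrite map_rcons flatten_rcons -catA.
have -> : flatten [seq [:: b; b] | b <- nseq m false] = nseq (2 * m) false.
  by elim: m => // m IH; rewrite mulnS /= IH.
by [].
Qed.

Lemma flatten_const (T U : Type) (s : seq T) (x : U) :
  flatten [seq [:: x; x] | _ <- s] = nseq (2 * size s) x.
Proof. by elim: s => [|y s IH]; rewrite ?muln0 // mulnS nseqD -IH. Qed.

Definition dimcost k := 5 + ((2 * e).+1 + (k.+1 * 10 + k.+1 * 10)).

Lemma emits_dimp f : f t1 = 0 -> f s1 = 0 ->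
  emits nctr z dimp f (enc_nat (2 ^ (f cK + f cK + e))) (dimcost (f cK)).
Proof.
move=> t0 s0 o; rewrite enc_nat_pow2.
have -> : 2 * (f cK + f cK + e) = 2 * f cK + (2 * f cK + 2 * e) by lia.
rewrite (nseqD (2 * f cK)) (nseqD (2 * f cK) (2 * e)) -!catA.
apply: spec_seqp; first exact: emits_str.
apply: spec_seqp.
  have := @emits_str nctr z (nseq (2 * e) false) f.
  rewrite size_nseq; apply.
have H : emits nctr z (fordown nctr t1 s1 cK (emit_str [:: false; false])) f
    (nseq (2 * f cK) false) ((f cK).+1 * 10).
  have := @emits_fordown nctr z t1 s1 cK (emit_str [:: false; false]) f (fun _ => [:: false; false]) 3 isT isT isT isT t0 s0.
  rewrite flatten_const size_iota; apply=> v _ o'; exact: emits_str.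
by apply: spec_seqp; apply: H.
Qed.

Variable L : nat.
Hypothesis rlL : forall c1 c2 c3, size (rl c1 c2 c3) <= L.
Hypothesis rlok : forall c1 c2 c3 f x1 y1 x2 y2 x3 y3,
  all (fun r => guardok nctr r.1 (Store (posf f x1 y1 x2 y2 x3 y3) [::])) (rl c1 c2 c3).

Definition tablecost X := poscost C X (poscost C X (poscost C X (L + 11))).

Lemma emits_tablep f : (forall i, 5 <= i <= 16 -> f i = 0) ->
  emits nctr z tablep f (tablestr f) (tablecost (f cX)).
Proof.
move=> f0; apply: emits_posp => //; first by split; apply: f0.
move=> x1 y1 c1 _ _ _; set f1 := setpos _ _ _ _ _ _ _.
have f1X : f1 cX = f cX by [].
rewrite -f1X; apply: emits_posp => //.
  by split; rewrite /f1 /setpos /updf /=; apply: f0.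
move=> x2 y2 c2 _ _ _; set f2 := setpos _ _ _ _ _ _ _.
have f2X : f2 cX = f1 cX by [].
rewrite -f2X; apply: emits_posp => //.
  by split; rewrite /f2 /f1 /setpos /updf /=; apply: f0.
move=> x3 y3 c3 _ _ _ o.
apply: (@spec_le _ _ _ _ _ (size (rl c1 c2 c3) + 11)); first by rewrite leq_add2r.
apply: emits_entp; exact: (rlok c1 c2 c3 f x1 y1 x2 y2 x3 y3).
Qed.

Definition outputp : prog unit :=
  tablep ;; emit_str (enc_nat 8) ;; dimp ;; dimp ;; dimp.

Definition outputcost X k := tablecost X + (20 + (dimcost k + (dimcost k + dimcost k))).

Lemma emits_outputp f : (forall i, 5 <= i <= 16 -> f i = 0) ->
  let N := 2 ^ (f cK + f cK + e) in
  emits nctr z outputp f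
    (enc_nat N ++ enc_nat N ++ enc_nat N ++ enc_nat 8 ++ tablestr f) (outputcost (f cX) (f cK)).
Proof.
move=> f0 N o.
rewrite -(catA (enc_nat N)) -2!(catA (enc_nat N)) -(catA (enc_nat 8)).
apply: spec_seqp; first exact: emits_tablep.
apply: spec_seqp.
  apply: (@spec_le _ _ _ _ _ (size (enc_nat 8)).+1) => //; exact: emits_str.
have t0 : f t1 = 0 by apply: f0.
have s0 : f s1 = 0 by apply: f0.
apply: spec_seqp; first exact: emits_dimp.
apply: spec_seqp; first exact: emits_dimp.
exact: emits_dimp.
Qed.

End Output.

(** * The encoding of games *)


Fixpoint nat_of_bits (s : seq bool) : nat := if s is b :: s' then b + 2 * nat_of_bits s' else 0.

Lemma bits_auxK fuel m : m <= fuel -> nat_of_bits (bits_aux fuel m) = m.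
Proof.
elim: fuel m => [|fuel IH] m; first by case: m.
case: m => // m mf.
transitivity (odd m.+1 + 2 * nat_of_bits (bits_aux fuel m.+1./2)); first by [].
by rewrite IH ?mul2n ?odd_double_half //; lia.
Qed.

(** The terminator 01 is not a doubled bit, so the end of a code is recognisable whatever follows
    it. *)
Lemma dbl_cat_inj s s' u v : dbl s ++ [:: false, true & u] = dbl s' ++ [:: false, true & v] ->
  s = s' /\ u = v.
Proof.
elim: s s' => [|x s IH] [|x' s'] //=; first by case.
- by case: x'.
- by case: x.
by case=> <- _ /IH[<- <-].
Qed.

Lemma enc_nat_cat_inj a b u v : enc_nat a ++ u = enc_nat b ++ v -> a = b /\ u = v.
Proof.
rewrite /enc_nat -!catA => /dbl_cat_inj[e ->]; split=> //.
by rewrite -(bits_auxK (leqnn a)) e bits_auxK.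
Qed.

Lemma enc_entry_cat_inj m (e e' : option 'I_m) u v :
  enc_entry e ++ u = enc_entry e' ++ v -> e = e' /\ u = v.
Proof.
case: e e' => [a|] [b|] /enc_nat_cat_inj[] // [] ab ->.
by split=> //; congr Some; apply: val_inj.
Qed.

(** [P] is left abstract so that the lemma can be nested over the three coordinates of a table. *)
Lemma flatten_map_cat_inj (T : eqType) (E E' : T -> seq bool) (P : T -> Prop) (s : seq T) u v :
  (forall x u v, E x ++ u = E' x ++ v -> P x /\ u = v) ->
  flatten (map E s) ++ u = flatten (map E' s) ++ v ->
  (forall x, x \in s -> P x) /\ u = v.
Proof.
move=> H; elim: s => [|x s IH] //=; rewrite -!catA => /H[Px /IH[Ps ->]].
by split=> // y; rewrite inE => /orP[/eqP->|/Ps].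
Qed.

Lemma flatten_flatten (T : Type) (S : seq (seq (seq T))) :
  flatten (flatten S) = flatten [seq flatten s | s <- S].
Proof. by elim: S => //= s S IH; rewrite flatten_cat IH. Qed.

Definition table n1 n2 n3 (E : 'I_n1 -> 'I_n2 -> 'I_n3 -> seq bool) : seq bool :=
  flatten [seq flatten [seq flatten [seq E x y w | w <- enum 'I_n3] | y <- enum 'I_n2] | x <- enum 'I_n1].

Lemma enc_gameE n1 n2 n3 m (g : pgame_form 'I_n1 'I_n2 'I_n3 'I_m) :
  enc_game g = enc_nat n1 ++ enc_nat n2 ++ enc_nat n3 ++ enc_nat m ++
               table (fun x y w => enc_entry (g x y w)).
Proof.
rewrite /enc_game; do 4 congr (_ ++ _).
rewrite flatten_flatten map_flatten flatten_flatten -[in LHS]map_comp -[in LHS]map_comp; congr flatten.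
apply: eq_map => x /=; rewrite -map_comp; congr flatten; exact: eq_map.
Qed.

Lemma assignable_ext (X1 X2 X3 A : Type) (g g' : pgame_form X1 X2 X3 A) :
  (forall x y w, g x y w = g' x y w) -> assignable g -> assignable g'.
Proof.
by move=> e [h1 [h2 [h3 H]]]; exists h1, h2, h3 => x y w a; rewrite -e; apply: H.
Qed.

Lemma enc_game_assignable n1 n2 n3 m n1' n2' n3' m'
    (g : pgame_form 'I_n1 'I_n2 'I_n3 'I_m) (g' : pgame_form 'I_n1' 'I_n2' 'I_n3' 'I_m') :
  enc_game g = enc_game g' -> assignable g -> assignable g'.
Proof.
rewrite !enc_gameE => /enc_nat_cat_inj[e1 /enc_nat_cat_inj[e2 /enc_nat_cat_inj[e3]]].
case/enc_nat_cat_inj=> e4; subst n1' n2' n3' m'.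
rewrite -[LHS]cats0 -[RHS]cats0 => /(@flatten_map_cat_inj _ _ _
  (fun x => forall y, y \in enum 'I_n2 -> forall w, w \in enum 'I_n3 -> g x y w = g' x y w))[].
  move=> x u v; apply: flatten_map_cat_inj => y {}u {}v; apply: flatten_map_cat_inj => w {}u {}v.
  exact: enc_entry_cat_inj.
by move=> H _; apply: assignable_ext => x y w; apply: H; rewrite mem_enum.
Qed.

Lemma ASSIGNABILITY_enc_game n1 n2 n3 m (g : pgame_form 'I_n1 'I_n2 'I_n3 'I_m) :
  0 < n1 -> 0 < n2 -> 0 < n3 -> 0 < m -> ASSIGNABILITY (enc_game g) <-> assignable g.
Proof.
move=> h1 h2 h3 h4; split=> [[n1' [n2' [n3' [m' [g' [_ [e ag]]]]]]]|ag].
  by apply: enc_game_assignable ag; rewrite -e.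
by exists n1, n2, n3, m, g.
Qed.

(** * Numbering positions in mixed radix *)

Section Positions.

Variables X C : nat.
Hypotheses (X0 : 0 < X) (C0 : 0 < C).

Definition tpos q := q %/ (X * C).
Definition jpos q := q %% (X * C) %/ C.
Definition cpos q := q %% (X * C) %% C.
Definition pos t j c := t * (X * C) + (j * C + c).

Lemma flatten_iota_mul (G : nat -> nat -> seq bool) m n : 0 < n ->
  flatten [seq flatten [seq G x y | y <- iota 0 n] | x <- iota 0 m] =
  flatten [seq G (q %/ n) (q %% n) | q <- iota 0 (m * n)].
Proof.
move=> n0; elim: m => [|m IH] //.
rewrite -[in LHS]addn1 iotaD map_cat flatten_cat IH mulSnr iotaD map_cat flatten_cat.
congr cat; rewrite /= cats0 add0n -[m * n]addn0 (iotaDl (m * n)) -map_comp; congr flatten.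
apply/eq_in_map => y; rewrite mem_iota /= => yn.
by rewrite divnMDl // modnMDl divn_small ?modn_small ?addn0.
Qed.

Lemma posstrE F : posstr C X F =
  flatten [seq F (tpos q) (jpos q) (cpos q) | q <- iota 0 (X * (X * C))].
Proof.
rewrite -(flatten_iota_mul (fun x q => F x (q %/ C) (q %% C))) ?muln_gt0 ?X0 //.
by congr flatten; apply: eq_map => x; rewrite (flatten_iota_mul (F x)).
Qed.

Lemma pos_inner j c : j < X -> c < C -> j * C + c < X * C.
Proof. by move=> jX cC; apply: (@leq_trans (j.+1 * C)); [rewrite mulSnr; lia | rewrite leq_mul2r jX orbT]. Qed.

Lemma posP t j c : j < X -> c < C ->
  [/\ tpos (pos t j c) = t, jpos (pos t j c) = j & cpos (pos t j c) = c].
Proof.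
move=> jX cC; have H := pos_inner jX cC.
rewrite /tpos /jpos /cpos /pos divnMDl ?muln_gt0 ?X0 // modnMDl (divn_small H) (modn_small H).
by rewrite divnMDl // modnMDl divn_small ?modn_small ?addn0.
Qed.

Lemma pos_lt t j c : t < X -> j < X -> c < C -> pos t j c < X * (X * C).
Proof.
move=> tX jX cC; have := pos_inner jX cC; rewrite /pos => H.
by apply: (@leq_trans (t.+1 * (X * C))); [rewrite mulSnr; lia | rewrite leq_mul2r tX orbT].
Qed.

Lemma tpos_lt q : q < X * (X * C) -> tpos q < X.
Proof. by rewrite /tpos ltn_divLR // muln_gt0 X0. Qed.

Lemma jpos_lt q : jpos q < X.
Proof. by rewrite /jpos ltn_divLR // ltn_mod muln_gt0 X0. Qed.

End Positions.

(** * The game as a table over ordinals *)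

Section Reduction.

Variable M : TM.

Definition log_atoms := #|atom_code M|.
Notation C := (2 ^ log_atoms).

Definition dec (c : nat) : option (atom M) :=
  nth None [seq Some (atom_dec x) | x <- enum (atom_code M)] c.
Definition code (a : atom M) : nat := index (atom_enc a) (enum (atom_code M)).

Lemma codeK a : dec (code a) = Some a.
Proof.
rewrite /dec (nth_map (atom_enc a)) ?index_mem ?mem_enum //.
by rewrite nth_index ?mem_enum // atom_encK.
Qed.

Lemma code_lt a : code a < C.
Proof.
apply: leq_trans (ltnW (ltn_expl _ (isT : 1 < 2))).
by rewrite /log_atoms cardE index_mem mem_enum.
Qed.

Definition coderules c1 c2 c3 : seq rule :=
  match dec c1, dec c2, dec c3 with
  | Some a1, Some a2, Some a3 => rules a1 a2 a3
  | _, _, _ => [::]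
  end.

Lemma size_coderules c1 c2 c3 : size (coderules c1 c2 c3) <= 3.
Proof.
rewrite /coderules; case: dec => [a1|] //; case: dec => [a2|] //; case: dec => [a3|] //.
rewrite /rules; by case: hornrule; case: linkrule; case: blockrule.
Qed.

Lemma hornrule_ok (a1 a2 a3 : atom M) g f x1 y1 x2 y2 x3 y3 : hornrule a1 a2 a3 = Some g ->
  guardok nctr g (Store (posf f x1 y1 x2 y2 x3 y3) [::]).
Proof.
case: a1 => [q s|s|s|||||||||b1]; case: a2 => [q0 s0|s0|s0|||||||||b2] //;
  case: a3 => [q' s'|s'|s'|||||||||b3] //=.
all: try by case: s.
all: try by case: s => [?|]; case: s0.
all: try by case: (nxt q s) => [[q1 w1] []]; try case: ifP; rewrite // => _ [<-].
all: try by case: s => [?|]; case: s0 => [?|]; case: s' => [?|] // [<-].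
all: try by case: s' => [[]|] // [<-].
all: try by move=> [<-].
all: try by case: q' => [?|]; case: s' => [?|] // [<-].
all: try by case: ifP => // _ [<-].
by case: s' => [b|] [<-]; rewrite /guardok /= /posf /setpos /updf /= ?eqxx.
Qed.

Lemma linkrule_ok (a1 a2 a3 : atom M) g f x1 y1 x2 y2 x3 y3 : linkrule a1 a2 a3 = Some g ->
  guardok nctr g (Store (posf f x1 y1 x2 y2 x3 y3) [::]).
Proof.
case: a1 => [q s|s|s|||||||||b1]; case: a2 => [q0 s0|s0|s0|||||||||b2] //;
  rewrite /linkrule; try case: ifP => // _; try by move=> [<-].
all: by case: a3 => // -[<-].
Qed.

Lemma coderules_ok c1 c2 c3 f x1 y1 x2 y2 x3 y3 :
  all (fun r => guardok nctr r.1 (Store (posf f x1 y1 x2 y2 x3 y3) [::])) (coderules c1 c2 c3).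
Proof.
rewrite /coderules; case: dec => [a1|] //; case: dec => [a2|] //; case: dec => [a3|] //.
rewrite /rules !all_cat; apply/and3P; split.
- case E: hornrule => [g|] //; rewrite /= andbT; exact: hornrule_ok E.
- case E: linkrule => [g|] //; rewrite /= andbT; exact: linkrule_ok E.
- by case: blockrule.
Qed.

Section Table.

Variables (z : seq bool) (f : nat -> nat) (Qb N : nat).
Notation W := (f cX).
Hypotheses (W0 : 0 < W) (fQ : f cQ = Qb) (zQ : size z <= Qb) (NE : N = W * (W * C)).

Definition reduced_game : pgame_form 'I_N 'I_N 'I_N 'I_8 := fun p1 p2 p3 =>
  firstrule z (coderules (cpos W C p1) (cpos W C p2) (cpos W C p3))
    (posf f (tpos W C p1) (jpos W C p1) (tpos W C p2) (jpos W C p2) (tpos W C p3) (jpos W C p3)).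

Lemma N0 : 0 < N.
Proof. by rewrite NE !muln_gt0 W0 expn_gt0. Qed.

Lemma reduced_game_assignable : assignable reduced_game <-> acceptable M z W Qb.
Proof.
have C0 : 0 < C by rewrite expn_gt0.
split=> [[h1 [h2 [h3 H]]]|[u uQ Hacc]].
  (* The default of [insubd] only serves typing, since coordinates below [W] give a number below
     [N]. *)
  pose p t j a : 'I_N := insubd (Ordinal N0) (pos W C t j (code a)).
  have pE t j a : t < W -> j < W -> p t j a = pos W C t j (code a) :> nat.
    move=> tW jW; have lt : pos W C t j (code a) < N by rewrite NE pos_lt ?code_lt.
    by rewrite /p val_insubd lt.
  apply: (@acceptable_of_sat M z f W Qb W0 erefl fQ zQ
    (fun t j a => h1 (p t j a)) (fun t j a => h2 (p t j a)) (fun t j a => h3 (p t j a))).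
  move=> x1 y1 x2 y2 x3 y3 a1 a2 a3 o x1W y1W x2W y2W x3W y3W E.
  apply/or3E; apply: H.
  rewrite /reduced_game !pE //.
  have [-> -> ->] := posP W0 C0 x1 y1W (code_lt a1).
  have [-> -> ->] := posP W0 C0 x2 y2W (code_lt a2).
  have [-> -> ->] := posP W0 C0 x3 y3W (code_lt a3).
  by rewrite /coderules !codeK.
pose h (g : nat -> nat -> atom M -> outcome) (q : 'I_N) : 'I_8 :=
  if dec (cpos W C q) is Some a then g (tpos W C q) (jpos W C q) a else inord 0.
exists (h (value1 z u)), (h (value2 z u)), (h (value3 z u)) => p1 p2 p3 o.
rewrite /reduced_game /h /coderules.
case: (dec (cpos _ _ p1)) => [a1|] //; case: (dec (cpos _ _ p2)) => [a2|] //.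
case: (dec (cpos _ _ p3)) => [a3|] // E; apply/or3E.
have tl (q : 'I_N) : tpos W C q < W by apply: tpos_lt => //; rewrite -NE.
have jl (q : 'I_N) : jpos W C q < W by apply: jpos_lt.
by apply: (@sat_of_acceptable M z f W Qb W0 erefl fQ zQ u uQ Hacc) E.
Qed.

Lemma map_enum_ord (G : nat -> seq bool) :
  [seq G (nat_of_ord p) | p <- enum 'I_N] = [seq G q | q <- iota 0 (W * (W * C))].
Proof. by rewrite -NE -val_enum_ord -map_comp. Qed.

Lemma enc_reduced_game : enc_game reduced_game =
  enc_nat N ++ enc_nat N ++ enc_nat N ++ enc_nat 8 ++ tablestr C coderules z f.
Proof.
have C0 : 0 < C by rewrite expn_gt0.
rewrite enc_gameE; do 4 congr cat; rewrite /tablestr posstrE // /table /reduced_game.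
rewrite -map_enum_ord; congr flatten; apply: eq_map => p1; rewrite posstrE //.
rewrite -map_enum_ord; congr flatten; apply: eq_map => p2; rewrite posstrE //.
by rewrite -map_enum_ord.
Qed.

End Table.

End Reduction.

(** * The reduction *)


Lemma enc_pair_pre w u : enc_pair w u = pre w ++ u.
Proof. by rewrite /enc_pair /pre -catA. Qed.

Lemma poly_bound_mono c k m n : m <= n -> poly_bound c k m <= poly_bound c k n.
Proof.
move=> mn; rewrite /poly_bound leq_mul2l; apply/orP; right.
by case: k => // k'; rewrite leq_exp2r.
Qed.

(** Rounding up to a power of two at most doubles the time bound, which keeps the width
    polynomial. *)
Lemma pow2_up_log_le m : 0 < m -> 2 ^ up_log 2 m <= 2 * m.
Proof.
case: m => [|[|m]] // _.
have := up_log_gtn (isT : 1 < 2) (isT : 1 < m.+2).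
have : 0 < up_log 2 m.+2 by rewrite up_log_gt0.
by case: (up_log 2 m.+2) => // e _ /= h; rewrite expnS; lia.
Qed.

Ltac polyb_solve := repeat first
  [ assumption | exact: polyb_id | exact: polyb_const | apply: polyb_add
  | apply: polyb_mul | apply: polyb_succ | apply: polyb_exp ].

Section NPHardness.

Variables (M : TM) (c k c' k' : nat).

Let Q n := guess_bound n c k.
Let e n := log_width n c k c' k'.

Lemma polyb_guess_bound : polyb Q.
Proof. by rewrite /Q /guess_bound /poly_bound; polyb_solve. Qed.

Lemma polyb_width : polyb (fun n => 2 ^ e n).
Proof.
have HQ := polyb_guess_bound.
apply: (@polyb_le _ (fun n => 2 * time_bound n c k c' k')).
  by move=> n; apply: pow2_up_log_le; rewrite /time_bound; lia.
by rewrite /time_bound /poly_bound; polyb_solve.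
Qed.

Lemma polyb_log_width : polyb e.
Proof. by apply: polyb_le polyb_width => n; apply/ltnW/ltn_expl. Qed.

Definition main_cost n :=
  setup_cost n c k c' k' + outputcost (2 ^ log_atoms M) (log_atoms M) 3 (2 ^ e n) (e n).

Lemma polyb_main_cost : polyb main_cost.
Proof.
have HQ := polyb_guess_bound; have HW := polyb_width; have He := polyb_log_width.
rewrite /main_cost /setup_cost /outputcost /tablecost /poscost /dimcost /poly_bound.
polyb_solve.
Qed.

Definition reduction (w : seq bool) : seq bool :=
  let f := setup_cnt (size w) c k c' k' in
  enc_game (@reduced_game M (pre w) f (2 ^ (f cK + f cK + log_atoms M))).

Lemma reduction_poly : poly_time_computable reduction.
Proof.
apply: (@poly_time_of_spec nctr isT
  (setup c k c' k' ;; outputp (2 ^ log_atoms M) (coderules M) (log_atoms M)) main_cost).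
  exact: polyb_main_cost.
move=> w; set f := setup_cnt (size w) c k c' k'.
exists (Store f (reduction w)); first by [].
apply: spec_seqp.
  by apply: spec_setup => i; rewrite /= size_pre.
have f0 i : 5 <= i <= 16 -> f i = 0 by do 17! [case: i => [|i] //].
have := @emits_outputp (2 ^ log_atoms M) (coderules M) (pre w) (log_atoms M) 3 (@size_coderules M)
  (@coderules_ok M) f f0 [::].
rewrite cats0 /reduction enc_reduced_game; first exact.
- by rewrite expn_gt0.
- by rewrite !expnD -mulnA.
Qed.

Hypothesis Vtime : forall v, exists t, t <= poly_bound c' k' (size v) /\
  halted (tm_run t (tm_init M v)).

(** The [2 ^ e n - 2] steps made by then are at least [t], by the choice of [time_bound], and a
    halted machine no longer changes. *)
Lemma trace_accepts v t n : size v <= Q n -> t <= poly_bound c' k' (size v) ->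
  halted (tm_run t (tm_init M v)) ->
  accq (row_q (trace M v (2 ^ e n).-1)) = tm_accept (cf_state (tm_run t (tm_init M v))).
Proof.
move=> vQ tb ht.
have H : time_bound n c k c' k' <= 2 ^ e n by apply: up_logP.
have H' := poly_bound_mono c' k' vQ.
have -> : (2 ^ e n).-1 = (2 ^ e n - 2).+1 by rewrite /time_bound in H; lia.
by rewrite trace_run /= (halted_run ht) //; rewrite /time_bound -/(Q n) in H; lia.
Qed.

End NPHardness.

Theorem mainTheorem13 : NP_hard ASSIGNABILITY.
Proof.
move=> L [V [c [k [[M [c' [k' HM]]] HL]]]].
exists (reduction M c k c' k'); split; first exact: reduction_poly.
move=> w; set f := setup_cnt (size w) c k c' k'.
have W0 : 0 < f cX by rewrite expn_gt0.
have NE : 2 ^ (f cK + f cK + log_atoms M) = f cX * (f cX * 2 ^ log_atoms M).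
  by rewrite !expnD -mulnA.
have zQ : size (pre w) <= guess_bound (size w) c k by rewrite size_pre leq_addr.
rewrite /reduction ASSIGNABILITY_enc_game ?expn_gt0 //.
rewrite (@reduced_game_assignable M (pre w) f (guess_bound (size w) c k)) // HL.
(* The certificate lengths allowed in the game are exactly those allowed by [in_NP]. *)
have gb : guess_bound (size w) c k - size (pre w) = poly_bound c k (size w).
  by rewrite size_pre /guess_bound addKn.
rewrite /acceptable gb.
have acc u : size u <= poly_bound c k (size w) ->
    (V (enc_pair w u) <-> accq (row_q (trace M (pre w ++ u) (f cX).-1))).
  move=> su; have [t [tb [ht hV]]] := HM (enc_pair w u).
  rewrite -hV enc_pair_pre in tb ht *.
  by rewrite (@trace_accepts M c k c' k' (pre w ++ u) t) // size_cat; lia.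
split=> [[u [su /(acc u su) Vu]]|[u su /(acc u su) Vu]]; by exists u.
Qed.
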